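(* Let $n\ge2$, let $\vec w\in\mathbb{R}^2$ be a vector not lying along either coordinate axis, let $T=\begin{pmatrix}\mu&0\\0&\eta\end{pmatrix}$ with non-zero real $-1<\mu,\eta<1$, and let $A$ be the attractor of the IFS $\Psi_n=\{F_k\}_{k=0}^{n-1}$, $F_k(\vec x)=T\vec x+(n-2k-1)\vec w$. The set $\operatorname{ext}(A)$ of extreme points of $A$ is given by (is the union of the entries of) the unique vector $(B_0,B_1,B_2,B_3)$ of non-empty compact sets solving the following system of equations: (a) if $\mu<0<\eta$ with $|\mu|<\eta$: $$B_0=F_0(B_0),\quad B_1=F_{n-1}(B_1),\quad B_2=\bigcup_{k=0}^{n-2}F_k(B_0)\cup F_{n-1}(B_3),\quad B_3=F_0(B_2)\cup\bigcup_{k=1}^{n-1}F_k(B_1);$$ (b) if $\mu<0<\eta$ with $|\mu|=\eta$: $$B_0=\bigcup_{k=0}^{n-1}F_k(B_1),\quad B_1=F_{n-1}(B_0),\quad B_2=\bigcup_{k=0}^{n-1}F_k(B_3),\quad B_3=F_0(B_2);$$ in this case the convex hull of $A$ is a quadrilateral, and if $A$ is convex, then $\eta\ge n^{-1/2}$ and each $B_k$ is an edge of $\partial A$; (c) if $0<\mu<\eta$: $$B_0=F_0(B_0),\quad B_1=\bigcup_{k=0}^{n-2}F_k(B_0)\cup F_{n-1}(B_1),\quad B_2=F_0(B_2)\cup\bigcup_{k=1}^{n-1}F_k(B_3),\quad B_3=F_{n-1}(B_3).$$ (d) If $0<\mu=\eta$, the attractor is either a Cantor set (when $\eta<1/n$)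 or an interval (when $\eta\ge 1/n$), so the convex hull is an interval along the line spanned by $\vec w$ whose endpoints are the fixed points of $F_0$ and $F_{n-1}$.
   Context: The attractor $A$ of $\{F_k\}$ is the unique non-empty compact set with $A=\bigcup_k F_k(A)$. $\operatorname{ext}(A)$ denotes $A\cap\partial\operatorname{conv}(A)$ (all points of $A$ on the boundary of its convex hull, not only vertices). *)

(* Defs.v *)
From HB Require Import structures.
From mathcomp Require Export all_boot all_order all_algebra.
From mathcomp Require Export all_classical all_reals all_analysis.
Export Order.TTheory GRing.Theory Num.Theory.
Export numFieldNormedType.Exports.
Set Implicit Arguments.
Unset Strict Implicit.
Unset Printing Implicit Defensive.
Local Open Scope classical_set_scope.
Local Open Scope ring_scope.

Definition diag2 (R : realType) (mu eta : R) : 'M[R]_2 :=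
  diag_mx (\row_(i < 2) if i == 0 then mu else eta).

(* Only the indices k < n belong to the IFS. *)
Definition ifs (R : realType) (mu eta : R) (w : 'cV[R]_2) (n k : nat)
    (x : 'cV[R]_2) : 'cV[R]_2 :=
  diag2 mu eta *m x + (n%:R - 2 * k%:R - 1) *: w.

Section Plane.
Variable R : realType.
Local Notation V := 'cV[R]_2.
Implicit Types (A B E P S : set V) (F : nat -> V -> V) (n : nat).

Definition nonempty_compact S := S !=set0 /\ compact S.

Definition is_attractor F n A :=
  nonempty_compact A /\ A = \bigcup_(k in `I_n) F k @` A.

Definition is_convex S := convex_set (S : set (convex_lmodType V)).

Definition convex_hull S : set V := smallest is_convex S.

Definition boundary S : set V := closure S `\` S°.

Definition ext A : set V := A `&` boundary (convex_hull A).

Definition segment (p q : V) : set V :=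
  [set (1 - t) *: p + t *: q | t in `[0, 1]].

(* A nondegenerate compact interval in the plane. *)
Definition is_segment S := exists p q : V, p <> q /\ S = segment p q.

Definition line_spanned (w : V) : set V := range (fun t : R => t *: w).

Definition is_fixed_point (f : V -> V) (p : V) := f p = p.

(* A filled quadrilateral: the hull of four points, each of them a genuine
   corner (not in the hull of the other three). *)
Definition is_quadrilateral P :=
  exists v : 'I_4 -> V,
    P = convex_hull (range v) /\
    forall i, ~ convex_hull (v @` [set j | j != i]) (v i).

(* Meant for convex P: edges are the nondegenerate segments cut out of P by a
   supporting line. *)
Definition is_edge P E :=
  is_segment E /\
  exists (u : 'rV[R]_2) (c : R),
    [/\ u <> 0,
        forall x, P x -> (u *m x) 0 0 <= c &
        E = P `&` [set x | (u *m x) 0 0 = c]].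

(* A homeomorphism {0,1}^nat -> S; g matters only on S, where it is f^-1. *)
Definition is_cantor_set S :=
  exists (f : cantor_space -> V) (g : V -> cantor_space),
    [/\ continuous f, {within S, continuous g}, range f = S & cancel f g].

Definition quad_system := set V -> set V -> set V -> set V -> Prop.

Definition is_solution (sys : quad_system) (B0 B1 B2 B3 : set V) :=
  [/\ nonempty_compact B0, nonempty_compact B1,
      nonempty_compact B2, nonempty_compact B3 & sys B0 B1 B2 B3].

Definition is_unique_solution (sys : quad_system) (B0 B1 B2 B3 : set V) :=
  is_solution sys B0 B1 B2 B3 /\
  forall C0 C1 C2 C3, is_solution sys C0 C1 C2 C3 ->
    [/\ C0 = B0, C1 = B1, C2 = B2 & C3 = B3].

(* For n >= 1, `I_n.-1 is {0, ..., n-2} and [set k | 1 <= k < n] is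
   {1, ..., n-1}. *)
Definition system_a F n : quad_system := fun B0 B1 B2 B3 =>
  [/\ B0 = F 0%N @` B0,
      B1 = F n.-1 @` B1,
      B2 = (\bigcup_(k in `I_n.-1) F k @` B0) `|` F n.-1 @` B3 &
      B3 = F 0%N @` B2 `|` \bigcup_(k in [set k | (1 <= k < n)%N]) F k @` B1].

Definition system_b F n : quad_system := fun B0 B1 B2 B3 =>
  [/\ B0 = \bigcup_(k in `I_n) F k @` B1,
      B1 = F n.-1 @` B0,
      B2 = \bigcup_(k in `I_n) F k @` B3 &
      B3 = F 0%N @` B2].

Definition system_c F n : quad_system := fun B0 B1 B2 B3 =>
  [/\ B0 = F 0%N @` B0,
      B1 = (\bigcup_(k in `I_n.-1) F k @` B0) `|` F n.-1 @` B1,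
      B2 = F 0%N @` B2 `|` \bigcup_(k in [set k | (1 <= k < n)%N]) F k @` B3 &
      B3 = F n.-1 @` B3].

End Plane.

(* Main.v *)
From HB Require Import structures.
Require Import Defs.
From mathcomp Require Import ring lra zify.
Set Implicit Arguments.
Unset Strict Implicit.
Unset Printing Implicit Defensive.
Local Open Scope classical_set_scope.
Local Open Scope ring_scope.

(* For a direction u let A_u be the set of points of A maximising u. A point of A is
   on the boundary of the hull iff it lies on some A_u with u <> 0. Since
   u (F_k x) = (u T) x + d_k (u w), the piece F_k A meets A_u iff k maximises
   d_k (u w), and then in F_k (A_(u T)); so A_u = F_0 (A_(u T)), F_(n-1) (A_(u T)) or
   the union of all F_k (A_(u T)), according to the sign of u w. In coordinates in which
   w = (1, 1), u T = (mu a, eta b) for u = (a, b), so that the signs met along u, u T,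
   u T^2, ... are those of a mu^j + b eta^j, and the sets B_i are the unions of A_u
   over closed cones of directions: half-planes and constant-sign directions in (a)
   and (c), the four directions (+-1, +-1) in (b). Uniqueness holds because all maps
   contract by a common factor. *)

(** The obstacle is a tie [u.1 + u.2 = 0]: there the face branches over all n maps, and ties might
    recur along the orbit of [u] under [dual]. In (a) and (c) the inequality [|mu| < eta] excludes
    this. A direction at a tie, or on the appropriate side of it, is sent into a cone [P b] that
    [dual] preserves and on which [u.1 + u.2] has a fixed sign. So each orbit meets at most one tie,
    and on [P b] a single map is ever optimal, which makes all its faces one and the same set. The
    half-planes are taken closed because the unions of faces must be compact; their overlap is
    harmless. In (b) nothing dominates: [dual] applied twice is multiplication by [eta ^+ 2], and
    along the four special directions every second one is a tie. There the forms [P] and [Q] with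
    coefficients (1, 1) and (-1, 1) take over, because every map exchanges them up to the factor
    [eta], and the hull is a box in these coordinates. The bit [b] treats opposite directions
    together. *)

Section Pairing.
Context {R : realType} (w : 'cV[R]_2).
Local Notation V := 'cV[R]_2.
Implicit Types (x y : V) (u : R * R).

(* The linear form with coefficients u in the coordinates that send w to (1, 1). *)
Definition pairing u x : R := u.1 * (x 0 0 / w 0 0) + u.2 * (x 1 0 / w 1 0).

Lemma pairing_lin u a b x y :
  pairing u (a *: x + b *: y) = a * pairing u x + b * pairing u y.
Proof. by rewrite /pairing !mxE; ring. Qed.

Lemma coord_div_continuous i : continuous (fun x : V => x i 0 / w i 0).
Proof.
move=> x; apply: (@continuousM _ _ (fun y : V => y i 0) (cst _)).
  exact: coord_continuous.
exact: cst_continuous.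
Qed.

(** Joint continuity matters because the compactness arguments vary the direction and the point at
    once. *)
Lemma pairing_continuous2 : continuous (fun ux : (R * R) * V => pairing ux.1 ux.2).
Proof.
have fst_cont (S T : topologicalType) : continuous (@fst S T) by move=> z; exact: cvg_fst.
have snd_cont (S T : topologicalType) : continuous (@snd S T) by move=> z; exact: cvg_snd.
move=> ux.
apply: (@continuousD _ _ _ (fun vy : (R * R) * V => vy.1.1 * (vy.2 0 0 / w 0 0))
  (fun vy : (R * R) * V => vy.1.2 * (vy.2 1 0 / w 1 0))).
  apply: (@continuousM _ _ (fun vy : (R * R) * V => vy.1.1)
    (fun vy : (R * R) * V => vy.2 0 0 / w 0 0)).
    by apply: (continuous_comp (f := fst) (g := fst)); exact: fst_cont.
  by apply: (continuous_comp (f := snd) (g := fun x : V => x 0 0 / w 0 0));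
    [exact: snd_cont|exact: coord_div_continuous].
apply: (@continuousM _ _ (fun vy : (R * R) * V => vy.1.2)
  (fun vy : (R * R) * V => vy.2 1 0 / w 1 0)).
  by apply: (continuous_comp (f := fst) (g := snd)); [exact: fst_cont|exact: snd_cont].
by apply: (continuous_comp (f := snd) (g := fun x : V => x 1 0 / w 1 0));
    [exact: snd_cont|exact: coord_div_continuous].
Qed.

Lemma pairing_continuous u : continuous (pairing u).
Proof.
move=> x; apply: (@continuousD _ _ _ (fun y : V => u.1 * (y 0 0 / w 0 0))
  (fun y : V => u.2 * (y 1 0 / w 1 0))).
  apply: (@continuousM _ _ (cst u.1)); first exact: cst_continuous.
  exact: coord_div_continuous.
apply: (@continuousM _ _ (cst u.2)); first exact: cst_continuous.
exact: coord_div_continuous.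
Qed.

Lemma pairingZ c u x : pairing (c * u.1, c * u.2) x = c * pairing u x.
Proof. by rewrite /pairing /=; ring. Qed.

End Pairing.

Section Norm.
Context {R : realType}.
Local Notation V := 'cV[R]_2.

Lemma ord2_cases (i : 'I_2) : i = 0 \/ i = 1.
Proof. by case: i => -[|[|//]] ?; [left|right]; exact/val_inj. Qed.

Lemma colP2 (x y : V) : x 0 0 = y 0 0 -> x 1 0 = y 1 0 -> x = y.
Proof.
move=> h0 h1; apply/colP => i.
by have [->|->] := ord2_cases i.
Qed.

Lemma mx_norm_le (x : V) (e : R) : 0 <= e ->
  `|x| <= e <-> `|x 0 0| <= e /\ `|x 1 0| <= e.
Proof.
move=> e0; rewrite -[`|x|]/(mx_norm x) mx_normrE; split.
  move=> /bigmax_leP[_ h]; split; first exact: (h (0, 0)).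
  exact: (h (1, 0)).
move=> [h0 h1]; apply/bigmax_leP; split => // -[i j] _ /=; rewrite ord1.
by have [->|->] := ord2_cases i.
Qed.

End Norm.

(** * Convex sets, hulls and segments *)

Section Convexity.
Context {R : realType}.
Local Notation V := 'cV[R]_2.
Implicit Types (S C A : set V).

Lemma is_convexP S : is_convex S <->
  forall x y t, 0 <= t -> t <= 1 -> S x -> S y -> S (t *: x + (1 - t) *: y).
Proof.
split=> h x y.
  move=> t t0 t1 Sx Sy.
  have t01 : Itv.spec (@Itv.num_sem R) (Itv.Real `[0%Z, 1%Z]) t.
    by rewrite /= /Itv.num_sem /= ger0_real// in_itv /= t0 t1.
  by have /set_mem := h x y (Itv.mk t01) (mem_set Sx) (mem_set Sy).
move=> t /set_mem Sx /set_mem Sy; apply/mem_set.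
by apply: h.
Qed.

Lemma sub_convex_hull A : A `<=` convex_hull A.
Proof. exact: sub_smallest. Qed.

Lemma convex_hull_min A C : is_convex C -> A `<=` C -> convex_hull A `<=` C.
Proof. exact: smallest_sub. Qed.

Lemma convex_hull_convex A : is_convex (convex_hull A).
Proof.
apply/is_convexP => x y t t0 t1 hx hy C [cC AC].
by apply: (is_convexP C).1 => //; [apply: hx|apply: hy].
Qed.

Lemma convex_hull_id C : is_convex C -> convex_hull C = C.
Proof.
by move=> cC; apply/seteqP; split; [exact: convex_hull_min|exact: sub_convex_hull].
Qed.

Lemma halfspace_convex (w : V) u c : is_convex [set x | pairing w u x <= c].
Proof.
apply/is_convexP => x y t t0 t1 /= hx hy; rewrite pairing_lin.
by nra.
Qed.

Lemma segment_convex (p q : V) : is_convex (segment p q).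
Proof.
apply/is_convexP => x y t t0 t1 [a + <-] [b + <-].
rewrite /= !in_itv /= => /andP[a0 a1] /andP[b0 b1].
exists (t * a + (1 - t) * b); first by rewrite /= in_itv /=; apply/andP; split; nra.
by apply/matrixP => i j; rewrite !mxE; ring.
Qed.

Lemma segment_sub_convex (p q : V) C : is_convex C -> C p -> C q -> segment p q `<=` C.
Proof.
move=> /is_convexP cC Cp Cq _ [t + <-]; rewrite /= in_itv /= => /andP[t0 t1].
have := cC p q (1 - t); rewrite opprB addrCA subrr addr0; apply => //; lra.
Qed.

End Convexity.

Section Contraction.
Context {R : realType} {V : normedModType R}.

(* Coinduction for contractions: the hypothesis unfolds a point of B i to
   arbitrary depth, and each unfolding gains a factor c on its distance to C i. *)
Lemma contracted_family_subset (I : Type) (F : nat -> V -> V) (c M : R)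
    (B C : I -> set V) :
  0 <= c < 1 ->
  (forall k x y, `|F k x - F k y| <= c * `|x - y|) ->
  (forall i x, B i x -> `|x| <= M) ->
  (forall i x, C i x -> `|x| <= M) ->
  (forall i, C i !=set0) ->
  (forall i, closed (C i)) ->
  (forall i x, B i x -> exists k j y,
     [/\ x = F k y, B j y & F k @` C j `<=` C i]) ->
  forall i, B i `<=` C i.
Proof.
move=> /andP[c0 c1] Fc BM CM C0 Ccl BC i x Bx.
have approx m : forall i x, B i x -> exists2 z, C i z & `|x - z| <= c ^+ m * (M + M).
  elim: m => [|m IH] {i x Bx} i x Bx.
    have [z Cz] := C0 i; exists z => //; rewrite expr0 mul1r.
    by apply: (le_trans (ler_normB _ _)); apply: lerD; [exact: BM Bx|exact: CM Cz].
  have [k [j [y [-> By sub]]]] := BC i x Bx.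
  have [z Cz yz] := IH j y By; exists (F k z); first by apply: sub; exists z.
  by rewrite exprS -mulrA (le_trans (Fc _ _ _))// ler_wpM2l.
have M0 : 0 <= M by rewrite (le_trans _ (BM i x Bx)).
apply: Ccl => U /nbhs_ballP[e /= e0 eU].
have cM : geometric (M + M) c @ \oo --> 0 by apply: cvg_geometric; rewrite ger0_norm.
have [m _ /(_ m (leqnn m)) me] : \forall m \near \oo, c ^+ m * (M + M) < e.
  move/cvgrPdist_lt : cM => /(_ e e0); apply: filterS => m.
  by rewrite sub0r normrN /= mulrC ger0_norm// mulr_ge0 ?exprn_ge0 ?addr_ge0.
have [z Cz xz] := approx m i x Bx; exists z; split => //; apply: eU.
by rewrite -ball_normE /=; exact: le_lt_trans me.
Qed.

End Contraction.

(** * Supporting lines of a plane set *)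

Section Separation.
Context {R : realType} (w : 'cV[R]_2) (w0 : w 0 0 <> 0) (w1 : w 1 0 <> 0).
Local Notation V := 'cV[R]_2.
Local Notation lin := (pairing w).
Implicit Types (x y : V) (u : R * R) (A C : set V).

Lemma pairing_inj x y :
  lin (1, 0) x = lin (1, 0) y -> lin (0, 1) x = lin (0, 1) y -> x = y.
Proof.
move/eqP: w0 => w0'; move/eqP: w1 => w1'.
rewrite /pairing /= !mul1r !mul0r !addr0 !add0r => h0 h1.
by apply: colP2; [exact: (divIf w0')|exact: (divIf w1')].
Qed.

Lemma convex3 C x y z a b c : is_convex C -> C x -> C y -> C z ->
  0 <= a -> 0 <= b -> 0 <= c -> a + b + c = 1 -> C (a *: x + b *: y + c *: z).
Proof.
move=> /is_convexP cC Cx Cy Cz a0 b0 c0 abc.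
have [ab0|abn0] := eqVneq (a + b) 0.
  have [-> -> ->] : [/\ a = 0, b = 0 & c = 1] by split; lra.
  by rewrite !scale0r scale1r !add0r.
have abpos : 0 < a + b by rewrite lt0r abn0 addr_ge0.
have -> : a *: x + b *: y + c *: z =
    (a + b) *: ((a / (a + b)) *: x + (1 - a / (a + b)) *: y) + (1 - (a + b)) *: z.
  have -> : c = 1 - (a + b) by lra.
  by apply/matrixP => i j; rewrite !mxE; field.
apply: (cC) => //; [lra..|].
by apply: cC => //; [exact: divr_ge0 (ltW _)|rewrite ler_pdivrMr// mul1r; lra].
Qed.

(* Work in the basis (c - z, its perpendicular) for some c in C, with coordinates
   s and t; the separating slope is the supremum of - s / t over the t > 0 part
   of C, which the t < 0 part bounds from above. *)
Lemma convex_separation C z : is_convex C -> ~ C z ->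
  exists2 u, u <> (0, 0) & forall y, C y -> lin u y <= lin u z.
Proof.
move=> cC nCz.
have [[c Cc]|C0] := pselect (C !=set0); last first.
  exists (1, 0); first by case=> /eqP; rewrite oner_eq0.
  by move=> y Cy; case: C0; exists y.
pose X := lin (1, 0); pose Y := lin (0, 1).
pose p := X c - X z.
pose q := Y c - Y z.
pose D := p ^+ 2 + q ^+ 2.
pose s y := lin (p, q) y - lin (p, q) z.
pose t y := lin (- q, p) y - lin (- q, p) z.
have D0 : 0 < D.
  rewrite lt0r paddr_eq0 ?sqr_ge0// !sqrf_eq0 addr_ge0 ?sqr_ge0// andbT.
  apply/negP => /andP[/eqP p0 /eqP q0]; apply: nCz.
  suff -> : z = c by [].
  by apply: pairing_inj; apply/eqP; rewrite eq_sym -subr_eq0; apply/eqP.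
have pairE a b y : lin (a, b) y = a * X y + b * Y y.
  by rewrite /X /Y /pairing /=; ring.
have sc : s c = D by rewrite /s /D !pairE  /p /q; ring.
have tc : t c = 0 by rewrite /t !pairE /p /q; ring.
(* In coordinates [(s, t)] centred at [z], the point [c] is [(D, 0)]. Non-negative weights on [y1],
   [y2], [c] that balance at the origin make [z] a convex combination of points of [C]; each case
   below produces such weights. *)
have absurd3 y1 y2 a b d : C y1 -> C y2 -> 0 <= a -> 0 <= b -> 0 <= d ->
    0 < a + b + d -> a * s y1 + b * s y2 + d * D = 0 -> a * t y1 + b * t y2 = 0 -> False.
  move=> Cy1 Cy2 a0 b0 d0 W0 es et; apply: nCz.
  pose W := a + b + d; have Wn0 : W != 0 by rewrite gt_eqF.
  suff -> : z = (a / W) *: y1 + (b / W) *: y2 + (d / W) *: c.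
    apply: convex3 => //; try exact: divr_ge0 (ltW _).
    by rewrite /W; field.
  have DW : D * W != 0 by rewrite mulf_neq0// gt_eqF.
  pose x1 := X y1 - X z.
  pose x2 := X y2 - X z.
  pose x1' := Y y1 - Y z.
  pose x2' := Y y2 - Y z.
  have sE1 : s y1 = p * x1 + q * x1' by rewrite /s !pairE /x1 /x1'; ring.
  have sE2 : s y2 = p * x2 + q * x2' by rewrite /s !pairE /x2 /x2'; ring.
  have tE1 : t y1 = p * x1' - q * x1 by rewrite /t !pairE /x1 /x1'; ring.
  have tE2 : t y2 = p * x2' - q * x2 by rewrite /t !pairE /x2 /x2'; ring.
  (* The passage to [(s, t)] is a rotation scaled by the square root of [D], so its transpose undoes
     it up to the factor [D]. *)
  have e1 : a * x1 + b * x2 + d * p = 0.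
    apply: (mulfI (lt0r_neq0 D0)); rewrite mulr0.
    have := congr1 (fun r => p * r) es; have := congr1 (fun r => q * r) et.
    rewrite !mulr0 sE1 sE2 tE1 tE2 /D => h1 h2.
    rewrite -[RHS](subrr 0) -{1}h2 -h1 /D; ring.
  have e2 : a * x1' + b * x2' + d * q = 0.
    apply: (mulfI (lt0r_neq0 D0)); rewrite mulr0.
    have := congr1 (fun r => q * r) es; have := congr1 (fun r => p * r) et.
    rewrite !mulr0 sE1 sE2 tE1 tE2 /D => h1 h2.
    rewrite -[RHS](addr0 0) -{1}h2 -h1 /D; ring.
  apply: pairing_inj; rewrite -[in RHS](scale1r (_ *: _ + _ *: _)) !pairing_lin mul1r.
    rewrite -/X; have -> : X c = p + X z by rewrite /p; ring.
    have -> : X y1 = x1 + X z by rewrite /x1; ring.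
    have -> : X y2 = x2 + X z by rewrite /x2; ring.
    apply: (mulfI Wn0); rewrite -[LHS]add0r -e1 /W; field; exact: Wn0.
  rewrite -/Y; have -> : Y c = q + Y z by rewrite /q; ring.
  have -> : Y y1 = x1' + Y z by rewrite /x1'; ring.
  have -> : Y y2 = x2' + Y z by rewrite /x2'; ring.
  apply: (mulfI Wn0); rewrite -[LHS]add0r -e2 /W; field; exact: Wn0.
have pq_neq0 : ~ (p = 0 /\ q = 0).
  by case=> p0 q0; move: D0; rewrite /D p0 q0 expr0n addr0 ltxx.
(* If [t] keeps one sign on [C], the line through [z] and [c] already separates. *)
have [npos|/existsNP[y1 /not_implyP[Cy1 /negP]]] :=
  pselect (forall y, C y -> t y <= 0).
  exists (- q, p); first by case=> /eqP; rewrite oppr_eq0 => /eqP ? ?; exact: pq_neq0.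
  by move=> y /npos; rewrite /t subr_le0.
rewrite -ltNge => ty1.
have [nneg|/existsNP[y2 /not_implyP[Cy2 /negP]]] :=
  pselect (forall y, C y -> 0 <= t y).
  exists (q, - p); first by case=> ? /eqP; rewrite oppr_eq0 => /eqP ?; exact: pq_neq0.
  by move=> y /nneg; rewrite /t !pairE; lra.
rewrite -ltNge => ty2.
pose S := [set - s y / t y | y in [set y | C y /\ 0 < t y]].
pose m := sup S.
have ub y : C y -> t y < 0 -> ubound S (s y / - t y).
  move=> Cy ty _ [y' [Cy' ty'] <-].
  rewrite ler_pdivrMr// mulrAC ler_pdivlMr ?oppr_gt0// leNgt; apply/negP => lt.
  (* The points lie on opposite sides of [t = 0]; weighting each by the distance of the other
     cancels [t], and the weight of [c] is what then cancels [s]. *)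
  apply: (absurd3 y' y (- t y) (t y') ((s y * - t y' - s y' * - t y) / D)) => //.
  - lra.
  - exact: ltW.
  - by apply: divr_ge0 (ltW _) => //; lra.
  - have : 0 <= (s y * - t y' - s y' * - t y) / D by apply: divr_ge0 (ltW _) => //; lra.
    lra.
  - by field; rewrite gt_eqF.
  - ring.
have S0 : S !=set0 by exists (- s y1 / t y1), y1.
have supS : has_sup S by split => //; exists (s y2 / - t y2); exact: ub.
(* As a form this is [- (s + m * t)] up to a constant, so the claim becomes [0 <= s + m * t] on
   [C]. *)
exists (- (p - m * q), - (q + m * p)).
  case=> e1 e2; have : (p - m * q) ^+ 2 + (q + m * p) ^+ 2 = 0.
    by rewrite -sqrrN e1 -[X in _ + X]sqrrN e2 expr0n addr0.
  have -> : (p - m * q) ^+ 2 + (q + m * p) ^+ 2 = (1 + m ^+ 2) * D by rewrite /D; ring.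
  by move/eqP; rewrite mulf_eq0 (gt_eqF D0) orbF gt_eqF// ltr_pwDl ?sqr_ge0.
move=> y Cy; suff : 0 <= s y + m * t y by rewrite /s /t !pairE; lra.
have [ty|ty|ty] := ltgtP (t y) 0.
- have : m <= s y / - t y by apply: ge_sup => //; exact: ub.
  by rewrite ler_pdivlMr ?oppr_gt0//; lra.
- have : - s y / t y <= m by apply: sup_ubound => //; [case: supS|exists y].
  by rewrite ler_pdivrMr//; lra.
- rewrite ty mulr0 addr0 leNgt; apply/negP => sy.
  (* Here [z] would lie between [y] and [c] on the line [t = 0]. *)
  apply: (absurd3 y y 0 D (- s y)) => //; [exact: ltW|lra|by lra|ring|].
  by rewrite ty; ring.
Qed.
End Separation.

Section Faces.
Context {R : realType} (w : 'cV[R]_2) (w0 : w 0 0 <> 0) (w1 : w 1 0 <> 0).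
Local Notation V := 'cV[R]_2.
Local Notation lin := (pairing w).
Implicit Types (x y : V) (u : R * R) (A C : set V).

Definition of_coords (a b : R) : V := \col_i (if i == 0 then a * w 0 0 else b * w 1 0).

Lemma pairing_of_coords u a b : lin u (of_coords a b) = u.1 * a + u.2 * b.
Proof.
rewrite /pairing !mxE /= !mulfK //; exact/eqP.
Qed.

Lemma pairing_continuousl x : continuous (lin^~ x).
Proof.
move=> u; apply: (@continuousD _ _ _ (fun v : R * R => v.1 * (x 0 0 / w 0 0))
  (fun v : R * R => v.2 * (x 1 0 / w 1 0))).
  apply: (@continuousM _ _ (fun v : R * R => v.1) (cst _)); last exact: cst_continuous.
  exact: cvg_fst.
apply: (@continuousM _ _ (fun v : R * R => v.2) (cst _)); last exact: cst_continuous.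
exact: cvg_snd.
Qed.

Lemma pairing_gap_continuous y :
  continuous (fun ux : (R * R) * V => lin ux.1 y - lin ux.1 ux.2).
Proof.
move=> ux; apply: (@continuousB _ _ _ (fun vz : (R * R) * V => lin vz.1 y)
  (fun vz : (R * R) * V => lin vz.1 vz.2)); last exact: pairing_continuous2.
apply: (continuous_comp (f := fst) (g := lin^~ y)); first exact: cvg_fst.
exact: pairing_continuousl.
Qed.

Definition face A u : set V :=
  [set x | A x /\ forall y, A y -> lin u y <= lin u x].

Lemma face_subset A u : face A u `<=` A.
Proof. by move=> x []. Qed.

(** The l^1 norm avoids square roots; any compact set of non-zero directions meeting every ray would
    serve. *)
Definition sphere : set (R * R) := [set u | `|u.1| + `|u.2| = 1].

Lemma sphere_scale u : u <> (0, 0) -> exists2 c, 0 < c & sphere (c * u.1, c * u.2).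
Proof.
move=> u0; have h : 0 < `|u.1| + `|u.2|.
  rewrite lt0r addr_ge0// andbT paddr_eq0// !normr_eq0.
  by apply/negP => /andP[/eqP h1 /eqP h2]; apply: u0; rewrite [u]surjective_pairing h1 h2.
exists (`|u.1| + `|u.2|)^-1; first by rewrite invr_gt0.
by rewrite /sphere /= !normrM ger0_norm ?invr_ge0 ?ltW// -mulrDr mulVf ?gt_eqF.
Qed.

Lemma sphere_neq0 u : sphere u -> u <> (0, 0).
Proof. by move=> + u0; rewrite /sphere /= u0 normr0 addr0 => /esym/eqP; rewrite oner_eq0. Qed.

Lemma sphere_compact : compact sphere.
Proof.
apply: (@subclosed_compact _ _ (`[(- 1 : R), 1]%classic `*` `[(- 1 : R), 1]%classic)).
- apply: (@preimage_closed _ _ (fun u : R * R => `|u.1| + `|u.2|) [set 1]).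
    move=> u _; apply: (@continuousD _ _ _ (fun v : R * R => `|v.1|) (fun v : R * R => `|v.2|)).
      by apply: (@cvg_norm _ _ _ _ _ (fun v : R * R => v.1)); exact: cvg_fst.
    by apply: (@cvg_norm _ _ _ _ _ (fun v : R * R => v.2)); exact: cvg_snd.
  exact: closed_eq.
- by apply: compact_setX; exact: segment_compact.
- move=> u; rewrite /sphere /= !in_itv /= -!ler_norml => h.
  by have := normr_ge0 u.1; have := normr_ge0 u.2; split; lra.
Qed.

(* A boundary point of the hull of A has a supporting line: otherwise, by
   compactness of the unit circle of directions, all points nearby fail to have one
   as well, so that none of them can be separated from the hull. *)
Lemma extE A : ext A = \bigcup_(u in [set u | u <> (0, 0)]) face A u.
Proof.
apply/seteqP; split=> x.
  move=> [Ax [_ nint]]; apply: contrapT => nface; apply: nint.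
  have nsup u : u <> (0, 0) -> exists2 y, A y & lin u x < lin u y.
    move=> u0; apply: contrapT => h; apply: nface; exists u => //; split => // y Ay.
    by rewrite leNgt; apply/negP => lt; apply: h; exists y.
  pose P (z : V) (u : R * R) := exists2 y, A y & lin u z < lin u y.
  have nP : \forall z \near x, sphere `<=` P z.
    apply: ((compact_near_coveringP sphere).1 sphere_compact V (nbhs x) P
      (nbhs_filter x)) => u /sphere_neq0 u0.
    have [y Ay xy] := nsup u u0.
    have : nbhs (u, x) ((fun ux : (R * R) * V => lin ux.1 y - lin ux.1 ux.2)
                         @^-1` [set r | 0 < r]).
      apply: pairing_gap_continuous; apply: (open_nbhs_nbhs); split; first exact: open_gt.
      by rewrite /= subr_gt0.
    by apply: filterS => -[v z] /=; rewrite subr_gt0 => h; exists y.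
  apply: filterS nP => z Pz; apply: contrapT => nz.
  have [u u0 sep] := convex_separation w0 w1 (@convex_hull_convex _ A) nz.
  have [c c0 /Pz[y Ay]] := sphere_scale u0.
  rewrite !pairingZ ltr_pM2l// ltNge => /negP; apply.
  by apply: sep; exact: sub_convex_hull.
move=> [u u0 [Ax xmax]]; split => //; split.
  by apply: subset_closure; exact: sub_convex_hull.
move=> /nbhs_ballP[e /= e0 eh].
(* A step of length less than [e] along [v] raises the form by [d * (u.1 ^+ 2 + u.2 ^+ 2)], so a
   ball around [x] inside the hull would leave the half-plane that contains the hull. *)
pose v := of_coords u.1 u.2; pose d := e / (2 * (1 + `|v|)).
have v1 : 0 < 1 + `|v| by rewrite ltr_pwDl.
have d0 : 0 < d by rewrite divr_gt0// mulr_gt0.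
have /eh hull_xdv : ball x e (x + d *: v).
  rewrite -ball_normE /= opprD addrA subrr sub0r normrN normrZ gtr0_norm//.
  rewrite /d mulrAC ltr_pdivrMr ?mulr_gt0// ltr_pM2l//.
  by have := normr_ge0 v; lra.
have := convex_hull_min (@halfspace_convex _ w u (lin u x)) xmax hull_xdv.
rewrite /= -[X in X + _](scale1r x) pairing_lin pairing_of_coords mul1r gerDl.
rewrite leNgt => /negP; apply; apply: mulr_gt0 => //.
rewrite lt0r addr_ge0 -?expr2 ?sqr_ge0// andbT paddr_eq0 ?sqr_ge0// !sqrf_eq0.
by apply/negP => /andP[/eqP h1 /eqP h2]; apply: u0; rewrite [u]surjective_pairing h1 h2.
Qed.

Lemma face_nonempty A u : nonempty_compact A -> face A u !=set0.
Proof.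
move=> [A0 cA].
have [x /set_mem Ax h] := compact_EVT_max A0 cA
  (continuous_subspaceT (@pairing_continuous _ w u)).
by exists x; split => // y /mem_set/h.
Qed.

(** The zero direction is removed because its face is all of [A]; [K] itself can then be a closed
    cone. *)
Definition faces A (K : set (R * R)) := \bigcup_(u in K `\ (0, 0)) face A u.

(* Only directions on the unit circle matter, and over a compact set of directions
   the graph of u |-> face A u is compact. *)
Lemma faces_compact A (K : set (R * R)) : compact A -> closed K ->
  (forall u c, 0 < c -> K u -> K (c * u.1, c * u.2)) ->
  compact (faces A K).
Proof.
move=> cA clK coneK.
pose G := [set ux : (R * R) * V |
  forall y, A y -> lin ux.1 y - lin ux.1 ux.2 <= 0].
have clG : closed G.
  have -> : G = \bigcap_(y in A)
      (fun ux : (R * R) * V => lin ux.1 y - lin ux.1 ux.2) @^-1` [set r | r <= 0].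
    by apply/seteqP; split.
  apply: closed_bigI => y _; apply: preimage_closed; last exact: closed_le.
  by move=> ux _; exact: pairing_gap_continuous.
have -> : faces A K = snd @` (((sphere `&` K) `*` A) `&` G).
  apply/seteqP; split=> x.
    move=> [u [Ku /= u0] fx]; have [c c0 Sc] := sphere_scale u0.
    exists ((c * u.1, c * u.2), x) => //; split.
      by split; [split => //; exact: coneK|exact: fx.1].
    by move=> y Ay /=; rewrite !pairingZ subr_le0 ler_pM2l//; exact: fx.2.
  move=> [[u z] [[[/= Su Ku] Az] Gz] <-]; exists u; first by split => //; exact: sphere_neq0.
  by split => // y /Gz /=; rewrite subr_le0.
apply: continuous_compact; first by apply: continuous_subspaceT => ux; exact: cvg_snd.
apply: compact_closedI => //; apply: compact_setX => //.
by apply: compact_closedI => //; exact: sphere_compact.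
Qed.

Lemma face_compact A u : compact A -> compact (face A u).
Proof.
move=> cA.
have -> : face A u =
    A `&` \bigcap_(y in A) (lin u) @^-1` [set r | lin u y <= r].
  by apply/seteqP; split.
apply: compact_closedI => //; apply: closed_bigI => y _.
apply: preimage_closed; last exact: closed_ge.
by move=> x _; exact: pairing_continuous.
Qed.

End Faces.

(** * The diagonal system and its maximising sets *)

Section Digits.
Context {R : realType} (n : nat) (n2 : (2 <= n)%N).
Implicit Types (k : nat) (u : R * R).

Definition digit k : R := n%:R - 2 * k%:R - 1.

Definition pos (b : bool) (r : R) : bool := if b then 0 < r else r < 0.

(* Digits decrease with the index, so the first map has the largest translation. *)
Definition top (b : bool) : nat := if b then 0%N else n.-1.

(** At a tie neither sign satisfies the premise, so every index is optimal. *)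
Definition optimal k u := forall b, pos b (u.1 + u.2) -> k = top b.

Lemma top_lt b : (top b < n)%N.
Proof. by case: b; rewrite /top; lia. Qed.

Lemma digit_le j k : (digit j <= digit k) = (k <= j)%N.
Proof. by rewrite /digit lerD2r lerD2l lerN2 ler_pM2l// ler_nat. Qed.

Lemma optimalP k u : (k < n)%N ->
  optimal k u <-> forall j, (j < n)%N -> digit j * (u.1 + u.2) <= digit k * (u.1 + u.2).
Proof.
move=> kn; split=> [opt j jn|h b].
  have [s0|s0|->] := ltgtP (u.1 + u.2) 0; last by rewrite !mulr0.
    by rewrite ler_nM2r// digit_le (opt false s0) /top; lia.
  by rewrite ler_pM2r// digit_le (opt true s0) /top.
have := h _ (top_lt b); case: b => /= /[swap] s0.
  by rewrite ler_pM2r// digit_le /top; lia.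
by rewrite ler_nM2r// digit_le /top; lia.
Qed.

Definition sg (b : bool) : R := if b then 1 else -1.

Lemma posE b r : pos b r = (0 < sg b * r).
Proof. by case: b; rewrite /pos /sg ?mul1r ?mulN1r ?oppr_gt0. Qed.

Lemma sg_sqr b : sg b * sg b = 1.
Proof. by case: b; rewrite /sg ?mulr1 ?mulrNN ?mulr1. Qed.

Lemma sg_neq0 b : sg b != 0.
Proof. by case: b; rewrite /sg ?oppr_eq0 oner_neq0. Qed.

Lemma digit_top b : digit (top b) = sg b * (n%:R - 1).
Proof.
case: b; rewrite /digit /top /sg; first by rewrite mulr0 subr0 mul1r.
by rewrite -subn1 natrB ?(ltnW n2)//; ring.
Qed.

Lemma digit_bound b k : (k < n)%N -> sg b * digit k <= n%:R - 1.
Proof.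
move=> kn; have h0 : (0 : R) <= k%:R by [].
have h1 : (k%:R : R) <= n%:R - 1 by rewrite lerBrDr natr1 ler_nat.
by case: b; rewrite /sg /digit; lra.
Qed.

End Digits.

(** * Contraction, uniqueness of solutions, and unfolding of faces *)

Section Ifs.
Context {R : realType} (n : nat) (w : 'cV[R]_2) (mu eta : R).
Context (w0 : w 0 0 <> 0) (w1 : w 1 0 <> 0).
Context (mu1 : -1 < mu < 1) (eta1 : -1 < eta < 1).
Local Notation V := 'cV[R]_2.
Local Notation lin := (pairing w).
Local Notation F := (ifs mu eta w n).
Local Notation face := (face w).
Local Notation digit := (@digit R n).
Local Notation top := (top n).
Local Notation optimal := (optimal n).
Implicit Types (x y : V) (u v : R * R) (A C : set V) (k : nat).

Lemma ifs_coord0 k x : F k x 0 0 = mu * x 0 0 + digit k * w 0 0.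
Proof.
by rewrite /ifs /diag2 mul_diag_mx !mxE.
Qed.

Lemma ifs_coord1 k x : F k x 1 0 = eta * x 1 0 + digit k * w 1 0.
Proof.
by rewrite /ifs /diag2 mul_diag_mx !mxE.
Qed.

Lemma pairing_ifs u k x :
  lin u (F k x) = lin (mu * u.1, eta * u.2) x + digit k * (u.1 + u.2).
Proof.
rewrite /pairing ifs_coord0 ifs_coord1 /=.
by field; apply/andP; split; exact/eqP.
Qed.

Definition ratio : R := Num.max `|mu| `|eta|.

Lemma ratio_bound : 0 <= ratio < 1.
Proof.
by rewrite /ratio le_max normr_ge0 /= gt_max !ltr_norml mu1 eta1.
Qed.

Lemma ifs_contracting k x y : `|F k x - F k y| <= ratio * `|x - y|.
Proof.
have /andP[r0 r1] := ratio_bound.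
have [h0 h1] := (mx_norm_le (x - y) (normr_ge0 _)).1 (lexx _).
have d0 : (F k x - F k y) 0 0 = mu * (x - y) 0 0.
  have -> : (F k x - F k y) 0 0 = F k x 0 0 - F k y 0 0 by rewrite mxE [X in _ + X]mxE.
  by rewrite !ifs_coord0 !mxE; ring.
have d1 : (F k x - F k y) 1 0 = eta * (x - y) 1 0.
  have -> : (F k x - F k y) 1 0 = F k x 1 0 - F k y 1 0 by rewrite mxE [X in _ + X]mxE.
  by rewrite !ifs_coord1 !mxE; ring.
apply/mx_norm_le; first by rewrite mulr_ge0.
by rewrite d0 d1 !normrM; split; apply: ler_pM => //; rewrite le_max lexx ?orbT.
Qed.

(** Turns the four unknowns into one finite family, the form in which the contraction argument is
    stated. *)
Definition pick4 (B0 B1 B2 B3 : set V) (i : bool * bool) : set V :=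
  if i.1 then (if i.2 then B3 else B2) else (if i.2 then B1 else B0).

Lemma compact_norm_bound (I : finType) (B : I -> set V) : (forall i, compact (B i)) ->
  exists M, forall i x, B i x -> `|x| <= M.
Proof.
move=> cB; have bound i : exists M, forall x, B i x -> `|x| <= M.
  have [M [_ BM]] := compact_bounded (cB i); exists (M + 1) => x Bx.
  by apply: BM Bx; rewrite ltrDl.
have [f fM] := choice bound.
by exists (\big[Num.max/0]_i f i) => i x /fM /le_trans; apply; exact: le_bigmax.
Qed.

(** Finiteness of [I] and compactness provide the common bound. Neither family has to solve a
    system: the lemma also places single points in [A], and [A] inside a segment. *)
Lemma attracted_subset (I : finType) (B C : I -> set V) :
  (forall i, compact (B i)) -> (forall i, nonempty_compact (C i)) ->
  (forall i x, B i x -> exists k j y,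
     [/\ x = F k y, B j y & F k @` C j `<=` C i]) ->
  forall i, B i `<=` C i.
Proof.
move=> cB cC BC.
have [M1 hM1] := compact_norm_bound cB.
have [M2 hM2] := compact_norm_bound (fun i => (cC i).2).
apply: (@contracted_family_subset R V I F ratio (Num.max M1 M2)) => //.
- exact: ratio_bound.
- exact: ifs_contracting.
- by move=> i x /hM1 h; rewrite le_max h.
- by move=> i x /hM2 h; rewrite le_max h orbT.
- by move=> i; case: (cC i).
- by move=> i; apply: compact_closed; [exact: norm_hausdorff|case: (cC i)].
Qed.

Lemma unique_solution (sys : quad_system R) B0 B1 B2 B3 :
  (forall B0 B1 B2 B3 C0 C1 C2 C3,
    is_solution sys B0 B1 B2 B3 -> is_solution sys C0 C1 C2 C3 ->
    forall i x, pick4 B0 B1 B2 B3 i x -> exists k j y,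
     [/\ x = F k y, pick4 B0 B1 B2 B3 j y &
       F k @` pick4 C0 C1 C2 C3 j `<=` pick4 C0 C1 C2 C3 i]) ->
  is_solution sys B0 B1 B2 B3 -> is_unique_solution sys B0 B1 B2 B3.
Proof.
move=> unfold.
have sub D0 D1 D2 D3 C0 C1 C2 C3 :
    is_solution sys D0 D1 D2 D3 -> is_solution sys C0 C1 C2 C3 ->
    forall i, pick4 D0 D1 D2 D3 i `<=` pick4 C0 C1 C2 C3 i.
  move=> sD sC; apply: attracted_subset; last exact: unfold.
    by case: sD => -[_ ?] [_ ?] [_ ?] [_ ?] _ [[] []].
  by case: sC => ? ? ? ? _ [[] []].
move=> sB; split=> // C0 C1 C2 C3 sC.
have h1 := sub _ _ _ _ _ _ _ _ sB sC; have h2 := sub _ _ _ _ _ _ _ _ sC sB.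
split; apply/seteqP; split.
- exact: (h2 (false, false)).
- exact: (h1 (false, false)).
- exact: (h2 (false, true)).
- exact: (h1 (false, true)).
- exact: (h2 (true, false)).
- exact: (h1 (true, false)).
- exact: (h2 (true, true)).
- exact: (h1 (true, true)).
Qed.

(** Each equation serves in both directions: in one solution it splits a point into a map and a
    point of some entry, in the other it sends that entry back by the same map. *)
Lemma system_a_unique B0 B1 B2 B3 : is_solution (system_a F n) B0 B1 B2 B3 ->
  is_unique_solution (system_a F n) B0 B1 B2 B3.
Proof.
apply: unique_solution => {}B0 {}B1 {}B2 {}B3 C0 C1 C2 C3.
case=> _ _ _ _ [eB0 eB1 eB2 eB3] [_ _ _ _ [eC0 eC1 eC2 eC3]] [[] []] x; rewrite /pick4 /=.
- rewrite {1}eB3 => -[[y By <-]|[k kn [y By <-]]].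
    by exists 0%N, (true, false), y; split => //=; rewrite [X in _ `<=` X]eC3; left.
  exists k, (false, true), y; split => //=; rewrite [X in _ `<=` X]eC3 => z hz.
  by right; exists k.
- rewrite {1}eB2 => -[[k kn [y By <-]]|[y By <-]].
    exists k, (false, false), y; split => //=; rewrite [X in _ `<=` X]eC2 => z hz.
    by left; exists k.
  by exists n.-1, (true, true), y; split => //=; rewrite [X in _ `<=` X]eC2; right.
- rewrite {1}eB1 => -[y By <-].
  by exists n.-1, (false, true), y; split => //=; rewrite [X in _ `<=` X]eC1.
- rewrite {1}eB0 => -[y By <-].
  by exists 0%N, (false, false), y; split => //=; rewrite [X in _ `<=` X]eC0.
Qed.

Lemma system_b_unique B0 B1 B2 B3 : is_solution (system_b F n) B0 B1 B2 B3 ->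
  is_unique_solution (system_b F n) B0 B1 B2 B3.
Proof.
apply: unique_solution => {}B0 {}B1 {}B2 {}B3 C0 C1 C2 C3.
case=> _ _ _ _ [eB0 eB1 eB2 eB3] [_ _ _ _ [eC0 eC1 eC2 eC3]] [[] []] x; rewrite /pick4 /=.
- rewrite {1}eB3 => -[y By <-].
  by exists 0%N, (true, false), y; split => //=; rewrite [X in _ `<=` X]eC3.
- rewrite {1}eB2 => -[k kn [y By <-]].
  exists k, (true, true), y; split => //=; rewrite [X in _ `<=` X]eC2 => z hz.
  by exists k.
- rewrite {1}eB1 => -[y By <-].
  by exists n.-1, (false, false), y; split => //=; rewrite [X in _ `<=` X]eC1.
- rewrite {1}eB0 => -[k kn [y By <-]].
  exists k, (false, true), y; split => //=; rewrite [X in _ `<=` X]eC0 => z hz.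
  by exists k.
Qed.

Lemma system_c_unique B0 B1 B2 B3 : is_solution (system_c F n) B0 B1 B2 B3 ->
  is_unique_solution (system_c F n) B0 B1 B2 B3.
Proof.
apply: unique_solution => {}B0 {}B1 {}B2 {}B3 C0 C1 C2 C3.
case=> _ _ _ _ [eB0 eB1 eB2 eB3] [_ _ _ _ [eC0 eC1 eC2 eC3]] [[] []] x; rewrite /pick4 /=.
- rewrite {1}eB3 => -[y By <-].
  by exists n.-1, (true, true), y; split => //=; rewrite [X in _ `<=` X]eC3.
- rewrite {1}eB2 => -[[y By <-]|[k kn [y By <-]]].
    by exists 0%N, (true, false), y; split => //=; rewrite [X in _ `<=` X]eC2; left.
  exists k, (true, true), y; split => //=; rewrite [X in _ `<=` X]eC2 => z hz.
  by right; exists k.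
- rewrite {1}eB1 => -[[k kn [y By <-]]|[y By <-]].
    exists k, (false, false), y; split => //=; rewrite [X in _ `<=` X]eC1 => z hz.
    by left; exists k.
  by exists n.-1, (false, true), y; split => //=; rewrite [X in _ `<=` X]eC1; right.
- rewrite {1}eB0 => -[y By <-].
  by exists 0%N, (false, false), y; split => //=; rewrite [X in _ `<=` X]eC0.
Qed.

Context (n2 : (2 <= n)%N) (A : set V) (hA : is_attractor F n A).

Definition dual u := (mu * u.1, eta * u.2).

Lemma attractor_ifs k x : (k < n)%N -> A x -> A (F k x).
Proof. by case: hA => _ eA kn Ax; rewrite eA; exists k => //; exists x. Qed.

Lemma attractor_cover x : A x -> exists k y, [/\ (k < n)%N, A y & x = F k y].
Proof. by case: hA => _ eA; rewrite {1}eA => -[k kn [y Ay <-]]; exists k, y. Qed.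

(** The form at [F k y] is a term in [y] plus a term in [k], so maximality can be tested by varying
    one while the other stays fixed. *)
Lemma face_unfold u x : face A u x ->
  exists k y, [/\ (k < n)%N, optimal k u, face A (dual u) y & x = F k y].
Proof.
move=> [/attractor_cover[k [y [kn Ay ->]]] xmax]; exists k, y; split => //.
  apply/(optimalP n2) => // j jn; have := xmax _ (attractor_ifs jn Ay).
  by rewrite !pairing_ifs lerD2l.
split=> // z Az; have := xmax _ (attractor_ifs kn Az).
by rewrite !pairing_ifs lerD2r.
Qed.

Lemma face_fold u k y : (k < n)%N -> optimal k u -> face A (dual u) y -> face A u (F k y).
Proof.
move=> kn /(optimalP n2) opt [Ay ymax]; split; first exact: attractor_ifs.
move=> _ /attractor_cover[j [z [jn Az ->]]].
by rewrite !pairing_ifs; apply: lerD; [exact: ymax|exact: opt].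
Qed.

Lemma face_nonempty_compact u : nonempty_compact (face A u).
Proof. by split; [apply: face_nonempty|apply: face_compact]; case: hA => -[]. Qed.

Section ConstantFace.
Context (b : bool) (P : set (R * R)).
Context (Pdual : forall u, P u -> pos b (u.1 + u.2) /\ P (dual u)).

Lemma optimal_top u : P u -> optimal (top b) u.
Proof.
move=> /Pdual[+ _]; rewrite /optimal /pos; case: b => h [] // h'.
  by have := lt_trans h h'; rewrite ltxx.
by have := lt_trans h h'; rewrite ltxx.
Qed.

(** Along the orbits of both directions the map [top b] is forced at every step, so their faces
    unfold through the same maps. *)
Lemma face_constant u v : P u -> P v -> face A u = face A v.
Proof.
suff sub u' v' : P u' -> P v' -> face A u' `<=` face A v'.
  by move=> Pu Pv; apply/seteqP; split; exact: sub.
move=> Pu Pv x fx.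
have [M AM] := @compact_norm_bound unit (fun=> A) (fun=> hA.1.2).
(* The index runs over all pairs of directions, an infinite type; the bound comes from [A].
   Membership in [P] is placed inside the left-hand sets, since the right-hand ones must be
   non-empty for every index. *)
apply: (@contracted_family_subset R V ((R * R) * (R * R)) F ratio M
  (fun uv => [set x | [/\ P uv.1, P uv.2 & face A uv.1 x]]) (fun uv => face A uv.2)
  ratio_bound ifs_contracting _ _ _ _ _ (u', v')) => //.
- by move=> uv y [_ _ /face_subset/(AM tt)].
- by move=> uv y /face_subset/(AM tt).
- by move=> uv; exact: (face_nonempty_compact _).1.
- move=> uv; apply: compact_closed; first exact: norm_hausdorff.
  exact: (face_nonempty_compact _).2.
- move=> uv y [P1 P2 /face_unfold[k [z [kn opt fz ->]]]].
  have kt : k = top b by apply: opt; case: (Pdual P1).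
  exists k, (dual uv.1, dual uv.2), z; split => //.
    by split => //=; [case: (Pdual P1)|case: (Pdual P2)].
  move=> _ [y' fy' <-]; apply: face_fold => //=.
  by rewrite kt; exact: optimal_top.
Qed.

Lemma face_fixed u : P u -> face A u = F (top b) @` face A u.
Proof.
move=> Pu; have [pu Pdu] := Pdual Pu.
apply/seteqP; split=> [x /face_unfold[k [y [_ opt fy ->]]]|_ [y fy <-]].
  by rewrite (opt b pu); exists y => //; rewrite (face_constant Pu Pdu).
apply: face_fold; [exact: (top_lt n2)|exact: optimal_top|].
by rewrite -(face_constant Pu Pdu).
Qed.

(* One entry of systems (a) and (c): K is a cone of directions; those on the side of
   sign b lead into P, and those on the other side into K'. *)
Lemma faces_unfold (K K' : set (R * R)) u1 :
  P u1 ->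
  (forall u, K u -> u <> (0, 0) -> pos b (u.1 + u.2) \/ u.1 + u.2 = 0 -> P (dual u)) ->
  (forall u, K u -> u <> (0, 0) -> pos (~~ b) (u.1 + u.2) ->
     K' (dual u) /\ dual u <> (0, 0)) ->
  (exists u, [/\ K u, u <> (0, 0), u.1 + u.2 = 0 & P (dual u)]) ->
  (forall u, K' u -> u <> (0, 0) -> P u \/
     exists v, [/\ K v, v <> (0, 0), dual v = u & ~~ pos b (v.1 + v.2)]) ->
  K' u1 -> u1 <> (0, 0) ->
  faces w A K = (\bigcup_(k in [set k | (k < n)%N /\ k <> top (~~ b)]) F k @` face A u1)
    `|` F (top (~~ b)) @` faces w A K'.
Proof.
move=> P1 KP KK' [v0 [Kv0 v00 sv0 Pdv0]] K'K K'1 u10.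
have top_neq : top b <> top (~~ b) by rewrite /top; case: b => /=; lia.
(* The direction [v0] is a tie, so its face contains the images of the constant face under all n
   maps. *)
have fold0 k x : (k < n)%N -> face A u1 x -> faces w A K (F k x).
  move=> kn fx; exists v0; first by split.
  apply: face_fold => //; last by rewrite -(face_constant P1 Pdv0).
  by rewrite /optimal sv0 => -[]; rewrite /pos ltxx.
apply/seteqP; split=> x.
  move=> [u [Ku /= u0] /face_unfold[k [y [kn opt fy ->]]]].
  have [neg|nneg] := boolP (pos (~~ b) (u.1 + u.2)).
    right; rewrite (opt _ neg); exists y => //.
    by have [K'u du0] := KK' _ Ku u0 neg; exists (dual u).
  have {}fy : face A u1 y.
    rewrite (face_constant P1 (KP _ Ku u0 _)) //.
    by move: nneg; rewrite /pos; case: b => /=; case: ltgtP; auto.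
  (* The first union omits this index; its image is recovered from the second part, because [u1]
     also lies in [K']. *)
  have [->|kt] := pselect (k = top (~~ b)).
    by right; exists y => //; exists u1.
  by left; exists k => //; exists y.
move=> [[k [kn _] [y fy <-]]|[y [u [K'u /= u0] fy] <-]]; first exact: fold0.
have [Pu|[v [Kv v_0 dv npos]]] := K'K _ K'u u0.
  by apply: fold0; [exact: (top_lt n2)|rewrite (face_constant P1 Pu)].
exists v; first by split.
apply: face_fold; [exact: (top_lt n2)| |by rewrite dv].
move=> b'; have [->//|bb'] := eqVneq b' (~~ b).
have -> : b' = b by case: b b' bb' => -[].
by rewrite (negbTE npos).
Qed.

End ConstantFace.

End Ifs.

(** * Opposite or equal signs with |mu| < eta *)

Section Systems.
Context {R : realType} (n : nat) (w : 'cV[R]_2) (mu eta : R).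
Context (w0 : w 0 0 <> 0) (w1 : w 1 0 <> 0).
Context (mu1 : -1 < mu < 1) (eta1 : -1 < eta < 1).
Local Notation V := 'cV[R]_2.
Local Notation F := (ifs mu eta w n).
Local Notation face := (face w).
Local Notation faces := (faces w).
Local Notation sg := (@sg R).
Context (n2 : (2 <= n)%N) (A : set V) (hA : is_attractor F n A).

Lemma halfplane_faces_compact (p : R * R -> R) : continuous p ->
  (forall c u, p (c * u.1, c * u.2) = c * p u) ->
  nonempty_compact (faces A [set u | 0 <= p u]) /\
  nonempty_compact (faces A [set u | p u <= 0]).
Proof.
move=> pc pZ; have cA : compact A := hA.1.2.
(* [p] is odd on the first axis, so [(1, 0)] or [(-1, 0)] lies on the required side. *)
have ne b : exists2 u, u <> (0, 0) & if b then 0 <= p u else p u <= 0.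
  have e0 : (1, 0) <> (0, 0) :> R * R by case=> /eqP; rewrite oner_eq0.
  have pN : p (-1, 0) = - p (1, 0).
    by have := pZ (-1) (1, 0); rewrite /= mulr1 mulr0 mulN1r.
  have e1 : (-1, 0) <> (0, 0) :> R * R by case=> /eqP; rewrite oppr_eq0 oner_eq0.
  have [h|h] := lerP 0 (p (1, 0)); case: b.
  - by exists (1, 0).
  - by exists (-1, 0); rewrite // pN oppr_le0.
  - by exists (-1, 0); rewrite // pN oppr_ge0 ltW.
  - by exists (1, 0); rewrite // ltW.
split; split.
- have [u u0 pu] := ne true; have [x fx] := face_nonempty w u hA.1.
  by exists x, u.
- apply: faces_compact => //.
    by apply: (@preimage_closed _ _ p [set r | 0 <= r]); [move=> u _; exact: pc|exact: closed_ge].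
  by move=> u c c0 /= pu; rewrite pZ mulr_ge0// ltW.
- have [u u0 pu] := ne false; have [x fx] := face_nonempty w u hA.1.
  by exists x, u.
- apply: faces_compact => //.
    by apply: (@preimage_closed _ _ p [set r | r <= 0]); [move=> u _; exact: pc|exact: closed_le].
  by move=> u c c0 /= pu; rewrite pZ pmulr_rle0.
Qed.

Lemma ext_halfplanes (p : R * R -> R) :
  ext A = faces A [set u | 0 <= p u] `|` faces A [set u | p u <= 0].
Proof.
rewrite (extE w0 w1); apply/seteqP; split=> x.
  by move=> [u u0 fu]; have [h|/ltW h] := lerP 0 (p u); [left|right]; exists u.
by move=> [|] [u [_ u0] fu]; exists u.
Qed.

Lemma face_sub_faces K u : K u -> u <> (0, 0) -> face A u `<=` faces A K.
Proof. by move=> Ku u0 x fx; exists u. Qed.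

Lemma ne_last_setE : [set k | (k < n)%N /\ k <> n.-1] = `I_n.-1.
Proof. by apply/seteqP; split=> k /=; lia. Qed.

Lemma ne_first_setE : [set k | (k < n)%N /\ k <> 0%N] = [set k | (1 <= k < n)%N].
Proof. by apply/seteqP; split=> k /=; lia. Qed.

Lemma pair_neq0 (u : R * R) : u <> (0, 0) <-> u.1 != 0 \/ u.2 != 0.
Proof.
split; last by case=> /eqP h e; apply: h; rewrite e.
move=> h; have [u1|] := eqVneq u.1 0; last by left.
by right; apply/eqP => u2; apply: h; rewrite [u]surjective_pairing u1 u2.
Qed.

Lemma sg_coords_neq0 b (u : R * R) : u <> (0, 0) ->
  sg b * u.1 != 0 \/ sg b * u.2 != 0.
Proof. by move=> /pair_neq0; rewrite !mulf_eq0 (negbTE (sg_neq0 b)). Qed.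

Lemma pos_or_zero_ge0 b r : pos b r \/ r = 0 -> 0 <= sg b * r.
Proof. by rewrite posE => -[/ltW|->]; rewrite ?mulr0. Qed.

Lemma pos_of_sum (a b : R) : a <= 0 -> 0 <= a + b -> a != 0 \/ b != 0 -> 0 < b.
Proof.
move=> a0 ab h; rewrite lt_neqAle; apply/andP; split; last by lra.
by apply/eqP => b0; case: h => /eqP; apply; lra.
Qed.

Lemma dual_neq0 u : mu != 0 -> eta != 0 -> u <> (0, 0) -> dual mu eta u <> (0, 0).
Proof.
by move=> m e /pair_neq0 u0; apply/pair_neq0; rewrite /= !mulf_eq0 !negb_or m e.
Qed.

Lemma dual_div u : mu != 0 -> eta != 0 -> dual mu eta (u.1 / mu, u.2 / eta) = u.
Proof.
move=> m e.
by rewrite /dual /= mulrCA divff// mulrCA divff// !mulr1 -surjective_pairing.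
Qed.

Lemma div_neq0 u : mu != 0 -> eta != 0 -> u <> (0, 0) -> (u.1 / mu, u.2 / eta) <> (0, 0).
Proof.
move=> m e /pair_neq0 u0; apply/pair_neq0.
by rewrite /= !mulf_eq0 !negb_or !invr_eq0 m e !andbT.
Qed.

Lemma sg_dir_neq0 b : (0, sg b) <> (0, 0) :> R * R.
Proof. by apply/pair_neq0; right; exact: sg_neq0. Qed.

(** * Case (a): [mu] negative, smaller than [eta] in absolute value *)

Section CaseA.
Context (mu_neg : mu < 0) (eta_pos : 0 < eta) (mu_eta : - eta < mu).

(** The cone around [(0, sg b)] where the second coordinate strictly dominates; multiplying it by
    the larger factor preserves the dominance. *)
Let P (b : bool) := [set u : R * R | - (sg b * u.2) < sg b * u.1 < sg b * u.2].

Let P_dual b u : P b u -> pos b (u.1 + u.2) /\ P b (dual mu eta u).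
Proof.
move: (mu_neg) (mu_eta) => m_neg m_eta.
rewrite posE mulrDr => /andP[h1 h2]; split; first by lra.
rewrite /P /= !(mulrCA (sg b)).
set p := sg b * u.1 in h1 h2 *; set q := sg b * u.2 in h1 h2 *.
have g1 : 0 < (eta + mu) * q by apply: mulr_gt0; lra.
have g2 : 0 < - mu * (q + p) by apply: mulr_gt0; lra.
have g3 : 0 < - mu * (q - p) by apply: mulr_gt0; lra.
by apply/andP; split; lra.
Qed.

Let P_dir b : P b (0, sg b).
Proof. by rewrite /P /= sg_sqr mulr0 ltr01 andbT oppr_lt0. Qed.

(** Since [mu < 0], [dual] reverses the sign of the first coordinate and each half-plane feeds the
    opposite one. This is why [B2] and [B3] refer to each other. *)
Lemma system_a_entry b :
  faces A [set u | sg b * u.1 <= 0] =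
  (\bigcup_(k in [set k | (k < n)%N /\ k <> top n (~~ b)]) F k @` face A (0, sg b))
    `|` F (top n (~~ b)) @` faces A [set u | 0 <= sg b * u.1].
Proof.
move: (mu_neg) (eta_pos) (mu_eta) => m_neg e_pos m_eta.
have mun : mu != 0 by rewrite lt_eqF.
have etan : eta != 0 by rewrite gt_eqF.
apply: (faces_unfold w0 w1 mu1 eta1 n2 hA (@P_dual b)) => //.
- move=> u u1 u0 /pos_or_zero_ge0; rewrite mulrDr => s0.
  have u2 := pos_of_sum u1 s0 (sg_coords_neq0 b u0).
  rewrite /P /= !(mulrCA (sg b)).
  set p := sg b * u.1 in u1 s0 u2 *; set q := sg b * u.2 in s0 u2 *.
  have h1 : 0 <= mu * p by rewrite nmulr_rge0.
  have h2 : 0 < (eta + mu) * q by apply: mulr_gt0 => //; lra.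
  have h3 : 0 <= - mu * (p + q) by apply: mulr_ge0 => //; lra.
  have h4 : 0 < eta * q by exact: mulr_gt0.
  by apply/andP; split; lra.
- move=> u u1 u0 _; split; last exact: dual_neq0.
  by rewrite /= mulrCA nmulr_rge0.
- exists (- sg b, sg b); split => /=; [|by apply/pair_neq0; right; exact: sg_neq0| |].
  + by rewrite mulrN sg_sqr; lra.
  + by rewrite addNr.
  + rewrite /P /= !(mulrCA (sg b)) mulrN sg_sqr.
    by apply/andP; split; lra.
(* By contraposition: a preimage under [dual] lying strictly on the side [b] would have been sent
   into [P b]. *)
- move=> u /= u1 u0; have [h|h] := pselect (P b u); [by left|right].
  exists (u.1 / mu, u.2 / eta); split => /=.
  + by rewrite mulrA ler_ndivrMr// mul0r.
  + exact: div_neq0.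
  + exact: dual_div.
  + rewrite posE mulrDr !mulrA; apply/negP => s0; apply: h; rewrite /P /=.
    set p := sg b * u.1 in u1 s0 *; set q := sg b * u.2 in s0 *.
    have e1 : 0 < (p / mu + q / eta) * eta by exact: mulr_gt0.
    have e2 : (p / mu + q / eta) * eta = p / mu * eta + q by field; apply/andP.
    have e3 : p / mu * (eta + mu) <= 0.
      by apply: mulr_le0_ge0; [rewrite ler_ndivrMr// mul0r|lra].
    have e4 : p / mu * mu = p by rewrite divfK.
    by apply/andP; split; lra.
- by rewrite /= mulr0.
- exact: sg_dir_neq0.
Qed.

Lemma system_a_solution : exists B0 B1 B2 B3 : set V,
  is_unique_solution (system_a F n) B0 B1 B2 B3 /\ ext A = B0 `|` B1 `|` B2 `|` B3.
Proof.
exists (face A (0, 1)), (face A (0, -1)), (faces A [set u | u.1 <= 0]),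
  (faces A [set u | 0 <= u.1]).
have [c3 c2] : nonempty_compact (faces A [set u | 0 <= u.1]) /\
    nonempty_compact (faces A [set u | u.1 <= 0]).
  by apply: halfplane_faces_compact => // u; exact: cvg_fst.
split; last first.
  (* The vertical directions lie in both closed half-planes, so [B0] and [B1] are already contained
     in [B2] and in [B3]. *)
  rewrite (ext_halfplanes fst) [LHS]setUC; apply/seteqP; split=> x.
    by case=> h; [left; right|right].
  move=> [[[h|h]|h]|h]; [left|left|by left|by right].
    by apply: (face_sub_faces _ (@sg_dir_neq0 true) h); exact: lexx.
  by apply: (face_sub_faces _ (@sg_dir_neq0 false) h); exact: lexx.
have le_true : [set u : R * R | u.1 <= 0] = [set u | sg true * u.1 <= 0].
  by apply/seteqP; split=> u; rewrite /= mul1r.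
have ge_true : [set u : R * R | 0 <= u.1] = [set u | 0 <= sg true * u.1].
  by apply/seteqP; split=> u; rewrite /= mul1r.
have le_false : [set u : R * R | u.1 <= 0] = [set u | 0 <= sg false * u.1].
  by apply/seteqP; split=> u; rewrite /= mulN1r oppr_ge0.
have ge_false : [set u : R * R | 0 <= u.1] = [set u | sg false * u.1 <= 0].
  by apply/seteqP; split=> u; rewrite /= mulN1r oppr_le0.
apply: system_a_unique => //; split => //.
- exact: (face_nonempty_compact hA).
- exact: (face_nonempty_compact hA).
split.
- exact: (face_fixed w0 w1 mu1 eta1 n2 hA (@P_dual true) (@P_dir true)).
- exact: (face_fixed w0 w1 mu1 eta1 n2 hA (@P_dual false) (@P_dir false)).
- by rewrite le_true (system_a_entry true) ne_last_setE ge_true.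
- by rewrite ge_false (system_a_entry false) ne_first_setE le_false setUC.
Qed.

End CaseA.

(** * Case (c): [0 < mu < eta] *)

Section CaseC.
Context (mu_pos : 0 < mu) (mu_eta : mu < eta).

(** The cone of case (a) would miss [(sg b, 0)], which [dual] merely rescales; this one keeps
    everything in the half-plane that is strictly on the side [b] of the tie line. *)
Let P (b : bool) := [set u : R * R | 0 <= sg b * u.2 /\ 0 < sg b * u.1 + sg b * u.2].

Let P_dual b u : P b u -> pos b (u.1 + u.2) /\ P b (dual mu eta u).
Proof.
move: (mu_pos) (mu_eta) => m_pos m_eta.
rewrite posE mulrDr => -[h1 h2]; split => //.
rewrite /P /= !(mulrCA (sg b)).
set p := sg b * u.1 in h1 h2 *; set q := sg b * u.2 in h1 h2 *.
have g1 : 0 <= (eta - mu) * q by apply: mulr_ge0; lra.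
have g2 : 0 < mu * (p + q) by apply: mulr_gt0; lra.
have g3 : 0 <= mu * q by apply: mulr_ge0; lra.
by split; lra.
Qed.

Let P_dir b : P b (0, sg b).
Proof. by rewrite /P /= sg_sqr mulr0 add0r ler01 ltr01. Qed.

(** With both factors positive each half-plane is sent into itself, so [B1] and [B2] are decoupled
    from each other. *)
Lemma system_c_entry b :
  faces A [set u | 0 <= sg b * u.2] =
  (\bigcup_(k in [set k | (k < n)%N /\ k <> top n (~~ b)]) F k @` face A (0, sg b))
    `|` F (top n (~~ b)) @` faces A [set u | 0 <= sg b * u.2].
Proof.
move: (mu_pos) (mu_eta) => m_pos m_eta.
have eta_pos : 0 < eta by lra.
have mun : mu != 0 by rewrite gt_eqF.
have etan : eta != 0 by rewrite gt_eqF.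
apply: (faces_unfold w0 w1 mu1 eta1 n2 hA (@P_dual b)) => //.
- move=> u u2 u0 /pos_or_zero_ge0; rewrite mulrDr => s0.
  have nz := sg_coords_neq0 b u0.
  rewrite /P /= !(mulrCA (sg b)).
  set p := sg b * u.1 in s0 nz *; set q := sg b * u.2 in u2 s0 nz *.
  have h1 : 0 <= mu * (p + q) by apply: mulr_ge0 => //; lra.
  split; first by apply: mulr_ge0 => //; lra.
  have [q0|q0|q0] := ltgtP q 0; first by move: (le_lt_trans u2 q0); rewrite ltxx.
    have h2 : 0 < (eta - mu) * q by apply: mulr_gt0 => //; lra.
    lra.
  rewrite q0 mulr0 addr0; apply: mulr_gt0 => //; rewrite lt0r.
  by rewrite q0 addr0 in s0; rewrite s0 andbT; case: nz => //; rewrite q0 eqxx.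
- move=> u u2 u0 _; split; last exact: dual_neq0.
  by rewrite /= mulrCA mulr_ge0// ltW.
- exists (- sg b, sg b); split => /=; [|by apply/pair_neq0; right; exact: sg_neq0| |].
  + by rewrite sg_sqr ler01.
  + by rewrite addNr.
  + by rewrite /P /= !(mulrCA (sg b)) mulrN sg_sqr; split; lra.
- move=> u /= u2 u0; have [h|h] := pselect (P b u); [by left|right].
  exists (u.1 / mu, u.2 / eta); split => /=.
  + by rewrite mulrA divr_ge0// ltW.
  + exact: div_neq0.
  + exact: dual_div.
  + rewrite posE mulrDr !mulrA; apply/negP => s0; apply: h; rewrite /P /=.
    set p := sg b * u.1 in s0 *; set q := sg b * u.2 in u2 s0 *.
    have e1 : 0 < (p / mu + q / eta) * mu by exact: mulr_gt0.
    have e2 : (p / mu + q / eta) * mu = p + q / eta * mu by field; apply/andP.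
    have e3 : 0 <= q / eta * (eta - mu).
      by apply: mulr_ge0; [apply: divr_ge0 => //; exact: ltW|lra].
    have e4 : q / eta * eta = q by rewrite divfK.
    by split; lra.
- by rewrite /= sg_sqr ler01.
- exact: sg_dir_neq0.
Qed.

Lemma system_c_solution : exists B0 B1 B2 B3 : set V,
  is_unique_solution (system_c F n) B0 B1 B2 B3 /\ ext A = B0 `|` B1 `|` B2 `|` B3.
Proof.
exists (face A (0, 1)), (faces A [set u | 0 <= u.2]), (faces A [set u | u.2 <= 0]),
  (face A (0, -1)).
have [c1 c2] : nonempty_compact (faces A [set u | 0 <= u.2]) /\
    nonempty_compact (faces A [set u | u.2 <= 0]).
  by apply: halfplane_faces_compact => // u; exact: cvg_snd.
split; last first.
  rewrite (ext_halfplanes snd); apply/seteqP; split=> x.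
    by case=> h; left; [left; right|right].
  move=> [[[h|h]|h]|h]; [left|by left|by right|right].
    by apply: (face_sub_faces _ (@sg_dir_neq0 true) h); exact: ler01.
  by apply: (face_sub_faces _ (@sg_dir_neq0 false) h); rewrite /= oppr_le0 ler01.
have ge_true : [set u : R * R | 0 <= u.2] = [set u | 0 <= sg true * u.2].
  by apply/seteqP; split=> u; rewrite /= mul1r.
have le_false : [set u : R * R | u.2 <= 0] = [set u | 0 <= sg false * u.2].
  by apply/seteqP; split=> u; rewrite /= mulN1r oppr_ge0.
apply: system_c_unique => //; split => //.
- exact: (face_nonempty_compact hA).
- exact: (face_nonempty_compact hA).
split.
- exact: (face_fixed w0 w1 mu1 eta1 n2 hA (@P_dual true) (@P_dir true)).
- by rewrite ge_true {1}(system_c_entry true) ne_last_setE.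
- by rewrite le_false {1}(system_c_entry false) ne_first_setE setUC.
- exact: (face_fixed w0 w1 mu1 eta1 n2 hA (@P_dual false) (@P_dir false)).
Qed.

End CaseC.

End Systems.

(** * The case mu = - eta *)

Section Edges.
Context {R : realType} (w : 'cV[R]_2).
Local Notation V := 'cV[R]_2.

Lemma pairing_rowE u (x : V) :
  ((\row_(j < 2) if j == 0 then u.1 / w 0 0 else u.2 / w 1 0) *m x) 0 0 = pairing w u x.
Proof.
rewrite mxE big_ord_recl big_ord1 /pairing !mxE /=.
have -> : lift ord0 ord0 = 1 :> 'I_2 by exact/val_inj.
by ring.
Qed.

Lemma face_is_edge A u : w 0 0 <> 0 -> w 1 0 <> 0 -> u <> (0, 0) ->
  is_segment (face w A u) -> is_edge A (face w A u).
Proof.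
move=> w0 w1 u0 seg; split => //.
have [x fx] : face w A u !=set0.
  case: seg => p [q [_ ->]]; exists p; exists 0; first by rewrite /= in_itv /= lexx ler01.
  by rewrite subr0 scale1r scale0r addr0.
exists (\row_(j < 2) if j == 0 then u.1 / w 0 0 else u.2 / w 1 0), (pairing w u x).
split.
- move=> /rowP e; apply: u0; rewrite [u]surjective_pairing.
  have := e 0; have := e 1; rewrite !mxE /= => e1 e0.
  have -> : u.1 = 0 by rewrite -[u.1](divfK (x := w 0 0)) ?e0 ?mul0r//; exact/eqP.
  by have -> : u.2 = 0 by rewrite -[u.2](divfK (x := w 1 0)) ?e1 ?mul0r//; exact/eqP.
- by move=> y Ay; rewrite pairing_rowE; exact: fx.2.
- apply/seteqP; split=> y.
    move=> fy; split; first exact: fy.1.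
    rewrite /= pairing_rowE; apply/le_anti/andP.
    by split; [apply: fx.2; exact: fy.1|apply: fy.2; exact: fx.1].
  by move=> [Ay]; rewrite /= pairing_rowE => e; split => // z Az; rewrite e; exact: fx.2.
Qed.

End Edges.

Section CaseB.
Context {R : realType} (n : nat) (w : 'cV[R]_2) (eta : R).
Context (w0 : w 0 0 <> 0) (w1 : w 1 0 <> 0) (eta_pos : 0 < eta) (eta_lt1 : eta < 1).
Local Notation V := 'cV[R]_2.
Local Notation F := (ifs (- eta) eta w n).
Local Notation face := (face w).
Local Notation P := (pairing w (1, 1)).
Local Notation Q := (pairing w (-1, 1)).
Local Notation digit := (@digit R n).
Local Notation sg := (@sg R).
Context (n2 : (2 <= n)%N) (A : set V) (hA : is_attractor F n A).

Let eta_bounds : -1 < eta < 1.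
Proof. by rewrite eta_lt1 andbT (lt_trans _ eta_pos)// oppr_lt0. Qed.

Let mu_bounds : -1 < - eta < 1.
Proof. by rewrite ltrN2 eta_lt1 (lt_trans _ ltr01)// oppr_lt0. Qed.

Let nat2 : 2 <= n%:R :> R.
Proof. by rewrite ler_nat. Qed.

Let sqr_lt1 : eta ^+ 2 < 1.
Proof. by rewrite expr_lt1// ltW. Qed.

(** [maxP] and [maxQ] solve [maxP = eta * maxQ + 2 * (n%:R - 1)] and [maxQ = eta * maxP], the
    relations that the exchange of [P] and [Q] imposes on their maxima over [A]. *)
Definition maxP : R := 2 * (n%:R - 1) / (1 - eta ^+ 2).
Definition maxQ : R := eta * maxP.

Lemma maxP_gt0 : 0 < maxP.
Proof.
move: nat2 sqr_lt1 => h1 h2.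
by apply: divr_gt0; lra.
Qed.

Lemma maxQ_gt0 : 0 < maxQ.
Proof. exact: mulr_gt0 maxP_gt0. Qed.

Lemma maxPE : maxP = eta * maxQ + 2 * (n%:R - 1).
Proof.
move: sqr_lt1 => h; rewrite /maxQ /maxP; field.
by rewrite subr_eq0 gt_eqF.
Qed.

Lemma P_ifs k x : P (F k x) = eta * Q x + 2 * digit k.
Proof. by rewrite pairing_ifs// /pairing /=; ring. Qed.

Lemma Q_ifs k x : Q (F k x) = eta * P x.
Proof. by rewrite pairing_ifs// /pairing /=; ring. Qed.

Lemma PQ_inj x y : P x = P y -> Q x = Q y -> x = y.
Proof.
move=> eP eQ; apply: (pairing_inj w0 w1).
  have e z : pairing w (1, 0) z = (P z - Q z) / 2 by rewrite /pairing /=; lra.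
  by rewrite !e eP eQ.
have e z : pairing w (0, 1) z = (P z + Q z) / 2 by rewrite /pairing /=; lra.
by rewrite !e eP eQ.
Qed.

Definition of_PQ (p q : R) : V := of_coords w ((p - q) / 2) ((p + q) / 2).

Lemma P_of_PQ p q : P (of_PQ p q) = p.
Proof. by rewrite pairing_of_coords//=; field. Qed.

Lemma Q_of_PQ p q : Q (of_PQ p q) = q.
Proof. by rewrite pairing_of_coords//=; field. Qed.

Definition corner (b c : bool) := of_PQ (sg b * maxP) (sg c * maxQ).

(** Applied twice, this makes each corner a fixed point of a composition of two maps, hence a point
    of [A]. *)
Lemma corner_ifs b c : F (top n b) (corner c b) = corner b c.
Proof.
apply: PQ_inj; rewrite ?P_ifs ?Q_ifs ?P_of_PQ ?Q_of_PQ /maxQ.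
  by rewrite (digit_top n2) [in RHS]maxPE /maxQ; ring.
by ring.
Qed.

Lemma corner_attractor b c : A (corner b c).
Proof.
apply: (@attracted_subset _ n w (- eta) eta mu_bounds eta_bounds (bool * bool)%type
  (fun i => [set corner i.1 i.2]) (fun=> A) _ _ _ (b, c)) => //.
- by move=> i; exact: compact_set1.
- by move=> i; case: hA.
- move=> i _ ->; exists (top n i.1), (i.2, i.1), (corner i.2 i.1).
  rewrite corner_ifs; split => // _ [x Ax <-].
  by apply: (attractor_ifs hA) => //; exact: (top_lt n2).
Qed.

(** The maxima over [A] bound each other through one unfolding. Eliminating that of [Q] gives
    [M <= eta ^+ 2 * M + 2 * (n%:R - 1)] for that of [P], and [eta ^+ 2 < 1] yields the bound. *)
Lemma attractor_box x b : A x -> sg b * P x <= maxP /\ sg b * Q x <= maxQ.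
Proof.
move: (eta_pos) (eta_lt1) sqr_lt1 => e_pos e_lt1 e2.
have [xP [AxP maxxP]] := face_nonempty w (sg b, sg b) hA.1.
have [xQ [AxQ maxxQ]] := face_nonempty w (- sg b, sg b) hA.1.
have PE z : pairing w (sg b, sg b) z = sg b * P z by rewrite /pairing /=; ring.
have QE z : pairing w (- sg b, sg b) z = sg b * Q z by rewrite /pairing /=; ring.
have hQ : sg b * Q xQ <= eta * (sg b * P xP).
  have [k [y [kn Ay e]]] := attractor_cover hA AxQ.
  by rewrite {1}e Q_ifs mulrCA ler_pM2l// -!PE maxxP.
have hP : sg b * P xP <= eta * (sg b * Q xQ) + 2 * (n%:R - 1).
  have [k [y [kn Ay e]]] := attractor_cover hA AxP.
  rewrite {1}e P_ifs mulrDr !(mulrCA (sg b)); apply: lerD.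
    by rewrite ler_pM2l// -!QE maxxQ.
  by rewrite ler_pM2l//; exact: digit_bound.
have hP' : sg b * P xP <= maxP.
  rewrite /maxP ler_pdivlMr; last by lra.
  have : eta * (sg b * Q xQ) <= eta * (eta * (sg b * P xP)) by rewrite ler_pM2l.
  by lra.
move=> Ax; split; first by rewrite -PE (le_trans (maxxP _ Ax))// PE.
rewrite -QE (le_trans (maxxQ _ Ax))// QE (le_trans hQ)//.
by rewrite /maxQ ler_pM2l.
Qed.

Definition box : set V :=
  [set x | forall b, sg b * P x <= maxP /\ sg b * Q x <= maxQ].

Lemma boxP x : box x <-> `|P x| <= maxP /\ `|Q x| <= maxQ.
Proof.
rewrite !ler_norml; split=> [h|[/andP[h1 h2] /andP[h3 h4]] []]; rewrite /sg ?mul1r ?mulN1r.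
- have [] := h true; have [] := h false; rewrite /sg !mul1r !mulN1r => h1 h2 h3 h4.
  by split; apply/andP; split; lra.
- by [].
- by split; lra.
Qed.

Lemma box_convex : is_convex box.
Proof.
apply/is_convexP => x y t t0 t1 bx hy b; rewrite !pairing_lin.
have [x1 x2] := bx b; have [y1 y2] := hy b.
have t1' : 0 <= 1 - t by rewrite subr_ge0.
have comb s p q m : s * p <= m -> s * q <= m -> s * (t * p + (1 - t) * q) <= m.
  move=> /(ler_wpM2l t0) hp /(ler_wpM2l t1') hq; lra.
by split; exact: comb.
Qed.

Lemma box_sub_convex C : is_convex C -> (forall b c, C (corner b c)) -> box `<=` C.
Proof.
move=> /is_convexP cC Cc x /boxP; rewrite !ler_norml => -[/andP[p1 p2] /andP[q1 q2]].
move: maxP_gt0 maxQ_gt0 => mP mQ.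
(* Relative positions of [x] between opposite sides; [x] is the bilinear interpolation of the
   corners. *)
pose l := (P x + maxP) / (2 * maxP); pose k := (Q x + maxQ) / (2 * maxQ).
have [l0 l1] : 0 <= l /\ l <= 1.
  split; first by apply: divr_ge0; lra.
  by rewrite ler_pdivrMr; lra.
have [k0 k1] : 0 <= k /\ k <= 1.
  split; first by apply: divr_ge0; lra.
  by rewrite ler_pdivrMr; lra.
have -> : x = l *: (k *: corner true true + (1 - k) *: corner true false) +
    (1 - l) *: (k *: corner false true + (1 - k) *: corner false false).
  apply: PQ_inj; rewrite !pairing_lin ?P_of_PQ ?Q_of_PQ /sg /l /k; field.
    by rewrite gt_eqF//= gt_eqF.
  by rewrite gt_eqF//= gt_eqF.
by apply: (cC) => //; apply: cC.
Qed.

Lemma hull_box : convex_hull A = box.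
Proof.
apply/seteqP; split.
  by apply: convex_hull_min; [exact: box_convex|move=> x Ax b; exact: attractor_box].
apply: box_sub_convex; first exact: convex_hull_convex.
by move=> b c; apply: sub_convex_hull; exact: corner_attractor.
Qed.

Lemma hull_quadrilateral : is_quadrilateral (convex_hull A).
Proof.
pose v (i : 'I_4) := corner (i < 2)%N (odd i).
exists v; split.
  rewrite hull_box; apply/seteqP; split.
    apply: box_sub_convex; first exact: convex_hull_convex.
    move=> b c; apply: sub_convex_hull.
    exists (inord (if b then c : nat else 2 + c)%N) => //.
    by rewrite /v inordK; case: b c => -[].
  apply: convex_hull_min; first exact: box_convex.
  move=> _ [i _ <-]; rewrite -hull_box; apply: sub_convex_hull.
  exact: corner_attractor.
move=> i.
pose s := sg (i < 2)%N; pose t := sg (odd i).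
(* This is the form [s * P / maxP + t * Q / maxQ]: it equals 2 at corner [i], 0 at its neighbours
   and -2 at the opposite corner. *)
pose u := (s / maxP - t / maxQ, s / maxP + t / maxQ).
have uE b c : pairing w u (corner b c) = s * sg b + t * sg c.
  have -> : pairing w u (corner b c) =
      s / maxP * P (corner b c) + t / maxQ * Q (corner b c) by rewrite /pairing /=; ring.
  by rewrite P_of_PQ Q_of_PQ; field; rewrite !gt_eqF ?maxP_gt0 ?maxQ_gt0.
have sub : v @` [set j | j != i] `<=` [set x | pairing w u x <= 0].
  move=> _ [j /= ji <-]; rewrite uE /s /t /sg.
  case: i j ji {uE u s t v} => -[|[|[|[|//]]]] hi [] [|[|[|[|//]]]] hj //= ji; lra.
move=> /(convex_hull_min (@halfspace_convex _ w u 0) sub).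
rewrite /= uE /s /t !sg_sqr; lra.
Qed.

Definition faceP (b : bool) := face A (sg b, sg b).
Definition faceQ (b : bool) := face A (- sg b, sg b).

Let pairing_P b x : pairing w (sg b, sg b) x = sg b * P x.
Proof. by rewrite /pairing /=; ring. Qed.

Let pairing_Q b x : pairing w (- sg b, sg b) x = sg b * Q x.
Proof. by rewrite /pairing /=; ring. Qed.

Lemma facePE b : faceP b = A `&` [set x | sg b * P x = maxP].
Proof.
apply/seteqP; split=> x [Ax h]; split => //=.
  apply/le_anti; rewrite (attractor_box b Ax).1 /=.
  have := h _ (corner_attractor b true).
  by rewrite !pairing_P P_of_PQ mulrA sg_sqr mul1r.
by move=> y Ay; rewrite !pairing_P h; exact: (attractor_box b Ay).1.
Qed.

Lemma faceQE b : faceQ b = A `&` [set x | sg b * Q x = maxQ].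
Proof.
apply/seteqP; split=> x [Ax h]; split => //=.
  apply/le_anti; rewrite (attractor_box b Ax).2 /=.
  have := h _ (corner_attractor true b).
  by rewrite !pairing_Q Q_of_PQ mulrA sg_sqr mul1r.
by move=> y Ay; rewrite !pairing_Q h; exact: (attractor_box b Ay).2.
Qed.

(** [Q] vanishes on [w] and does not see the translations, so all n pieces reach its maximum. For
    [P] only the extreme translation does. *)
Lemma faceQ_unfold b : faceQ b = \bigcup_(k in `I_n) F k @` faceP b.
Proof.
have en : eta != 0 by rewrite gt_eqF.
have scale x : sg b * (eta * P x) = maxQ <-> sg b * P x = maxP.
  by rewrite mulrCA /maxQ; split=> [/(mulfI en)|->].
rewrite faceQE facePE; apply/seteqP; split=> x.
  move=> [/(attractor_cover hA)[k [y [kn Ay ->]]]]; rewrite /= Q_ifs => /scale e.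
  by exists k => //; exists y.
move=> [k kn [y [Ay e] <-]]; split; first exact: attractor_ifs.
by rewrite /= Q_ifs; exact/scale.
Qed.

Lemma faceP_unfold b : faceP b = F (top n b) @` faceQ b.
Proof.
have en : eta != 0 by rewrite gt_eqF.
have scale x : sg b * P (F (top n b) x) = maxP <-> sg b * Q x = maxQ.
  have -> : sg b * P (F (top n b) x) = eta * (sg b * Q x) + 2 * (n%:R - 1).
    rewrite P_ifs (digit_top n2).
    have -> : sg b * (eta * Q x + 2 * (sg b * (n%:R - 1))) =
      eta * (sg b * Q x) + sg b * sg b * (2 * (n%:R - 1)) by ring.
    by rewrite sg_sqr mul1r.
  by rewrite maxPE; split=> [/addIr/(mulfI en)|->].
apply/seteqP; split=> x.
  move=> fx; have [k [y [kn opt fy e]]] := face_unfold w0 w1 n2 hA fx.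
  have kt : k = top n b.
    apply: opt; rewrite posE /= mulrDr sg_sqr; exact: addr_gt0.
  exists y; last by rewrite e kt.
  rewrite faceQE; split; first exact: fy.1.
  by apply/scale; rewrite -kt -e; move: fx; rewrite -/(faceP b) facePE => -[].
move=> [y]; rewrite faceQE => -[Ay /= e] <-; rewrite facePE; split; last exact/scale.
by apply: (attractor_ifs hA) => //; exact: (top_lt n2).
Qed.

(* P and Q are extremal simultaneously at the corners, so a maximiser of s P + t Q is
   extremal for P if s <> 0, and for Q if t <> 0. *)
Lemma ext_faces : ext A = faceQ false `|` faceP false `|` faceQ true `|` faceP true.
Proof.
rewrite (extE w0 w1); apply/seteqP; split=> x; last first.
  have dP b : (sg b, sg b) <> (0, 0) by apply/pair_neq0; right; exact: sg_neq0.
  have dQ b : (- sg b, sg b) <> (0, 0) by apply/pair_neq0; right; exact: sg_neq0.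
  move=> [[[fx|fx]|fx]|fx].
  - by exists (- sg false, sg false); [exact: dQ|].
  - by exists (sg false, sg false); [exact: dP|].
  - by exists (- sg true, sg true); [exact: dQ|].
  - by exists (sg true, sg true); [exact: dP|].
move=> [u /= u0 [Ax xmax]].
pose s := (u.1 + u.2) / 2; pose t := (u.2 - u.1) / 2.
have uE z : pairing w u z = s * P z + t * Q z by rewrite /pairing /s /t /=; lra.
have [sE tE] : `|s| * maxP <= s * P x /\ `|t| * maxQ <= t * Q x.
  have := xmax _ (corner_attractor (0 <= s) (0 <= t)).
  rewrite !uE P_of_PQ Q_of_PQ.
  have abs r : r * sg (0 <= r) = `|r|.
    by rewrite /sg; case: ger0P => _; rewrite ?mulr1 ?mulrN1.
  rewrite (mulrA s (sg _)) (mulrA t (sg _)) !abs.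
  have bnd r p m : (forall b, sg b * p <= m) -> r * p <= `|r| * m.
    move=> h; have := h true; have := h false; rewrite /sg mul1r mulN1r.
    case: ger0P => r0 h1 h2; first by rewrite ler_wpM2l.
    by rewrite -mulrNN ler_wpM2l// oppr_ge0 ltW.
  have h1 : s * P x <= `|s| * maxP by apply: bnd => b; exact: (attractor_box b Ax).1.
  have h2 : t * Q x <= `|t| * maxQ by apply: bnd => b; exact: (attractor_box b Ax).2.
  by move=> hx; split; lra.
have extreme r p m : (forall b, sg b * p <= m) -> `|r| * m <= r * p ->
    forall b, 0 < sg b * r -> sg b * p = m.
  move=> pm rp b br; apply/le_anti; rewrite pm /= -(ler_pM2l br) mulrACA sg_sqr mul1r.
  suff <- : `|r| = sg b * r by [].
  by case: b br; rewrite /sg ?mul1r ?mulN1r ?oppr_gt0 => br; [rewrite gtr0_norm|rewrite ltr0_norm].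
have sgnP b : 0 < sg b * s -> faceP b x.
  move=> bs; rewrite facePE; split => //=.
  by apply: (extreme s) => // c; exact: (attractor_box c Ax).1.
have sgnQ b : 0 < sg b * t -> faceQ b x.
  move=> bt; rewrite faceQE; split => //=.
  by apply: (extreme t) => // c; exact: (attractor_box c Ax).2.
have [s0|s0|s0] := ltgtP s 0.
- by left; left; right; apply: sgnP; rewrite /sg mulN1r oppr_gt0.
- by right; apply: sgnP; rewrite /sg mul1r.
have [t0|t0|t0] := ltgtP t 0.
- by left; left; left; apply: sgnQ; rewrite /sg mulN1r oppr_gt0.
- by left; right; apply: sgnQ; rewrite /sg mul1r.
move: s0 t0; rewrite /s /t => s0 t0; case: u0.
by rewrite [u]surjective_pairing; congr pair; lra.
Qed.

Lemma system_b_faces :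
  is_unique_solution (system_b F n) (faceQ false) (faceP false) (faceQ true) (faceP true).
Proof.
apply: system_b_unique => //; split; try exact: (face_nonempty_compact hA).
split.
- exact: faceQ_unfold.
- exact: (faceP_unfold false).
- exact: faceQ_unfold.
- exact: (faceP_unfold true).
Qed.

(** * Case (b) with [A] convex: edges and the bound on [eta] *)

Section ConvexAttractor.
Context (convA : is_convex A).

Let A_box : A = box.
Proof. by rewrite -hull_box convex_hull_id. Qed.

Lemma faceP_segment b : faceP b = segment (corner b false) (corner b true).
Proof.
rewrite facePE; apply/seteqP; split=> x; last first.
  move=> sx; split.
    by apply: segment_sub_convex sx => //; exact: corner_attractor.
  case: sx => t _ <-; rewrite /= pairing_lin !P_of_PQ.
  by rewrite -mulrDl subrK mul1r mulrA sg_sqr mul1r.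
move=> [Ax /= e]; have [b1 _] := attractor_box true Ax; have [_ q1] := attractor_box true Ax.
have [_ q2] := attractor_box false Ax; move: q1 q2; rewrite /sg mul1r mulN1r => q1 q2.
move: maxQ_gt0 => mQ; exists ((Q x + maxQ) / (2 * maxQ)).
  rewrite /= in_itv /=; apply/andP; split; first by apply: divr_ge0; lra.
  by rewrite ler_pdivrMr; lra.
apply: PQ_inj; rewrite pairing_lin ?P_of_PQ ?Q_of_PQ.
  by rewrite -mulrDl subrK mul1r -e mulrA sg_sqr mul1r.
by rewrite /sg; field; rewrite gt_eqF.
Qed.

Lemma faceQ_segment b : faceQ b = segment (corner false b) (corner true b).
Proof.
rewrite faceQE; apply/seteqP; split=> x; last first.
  move=> sx; split.
    by apply: segment_sub_convex sx => //; exact: corner_attractor.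
  case: sx => t _ <-; rewrite /= pairing_lin !Q_of_PQ.
  by rewrite -mulrDl subrK mul1r mulrA sg_sqr mul1r.
move=> [Ax /= e]; have [p1 _] := attractor_box true Ax.
have [p2 _] := attractor_box false Ax; move: p1 p2; rewrite /sg mul1r mulN1r => p1 p2.
move: maxP_gt0 => mP; exists ((P x + maxP) / (2 * maxP)).
  rewrite /= in_itv /=; apply/andP; split; first by apply: divr_ge0; lra.
  by rewrite ler_pdivrMr; lra.
apply: PQ_inj; rewrite pairing_lin ?P_of_PQ ?Q_of_PQ.
  by rewrite /sg; field; rewrite gt_eqF.
by rewrite -mulrDl subrK mul1r -e mulrA sg_sqr mul1r.
Qed.

Lemma faceP_edge b : is_edge A (faceP b).
Proof.
apply: face_is_edge => //; first by apply/pair_neq0; right; exact: sg_neq0.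
exists (corner b false), (corner b true); split; last exact: faceP_segment.
move=> /(congr1 Q); rewrite !Q_of_PQ /sg; move: maxQ_gt0; lra.
Qed.

Lemma faceQ_edge b : is_edge A (faceQ b).
Proof.
apply: face_is_edge => //; first by apply/pair_neq0; right; exact: sg_neq0.
exists (corner false b), (corner true b); split; last exact: faceQ_segment.
move=> /(congr1 P); rewrite !P_of_PQ /sg; move: maxP_gt0; lra.
Qed.

(* On the edge Q = maxQ the second iterate acts on P as n contractions of ratio
   eta^2 with translations 2 d_k; for n eta^2 < 1 the midpoint between the first
   two of their images is missed. *)
Lemma convex_ratio : n%:R `^ (- 2^-1) <= eta.
Proof.
have n0 : 0 < n%:R :> R by move: nat2; lra.
have ne : 1 <= n%:R * eta ^+ 2.
  rewrite leNgt; apply/negP => lt1.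
  move: (nat2) (sqr_lt1) (eta_pos) maxP_gt0 maxQ_gt0 => h2 e1 e0 mP mQ.
  have mPE : maxP * (1 - eta ^+ 2) = 2 * (n%:R - 1) by rewrite /maxP divfK// subr_eq0 gt_eqF.
  (* The left side is the half-length of one image, whose centre is [2 * digit k]. Consecutive
     centres are 4 apart, so this bound leaves the midpoint [2 * (n%:R - 2)] of the first two
     uncovered. *)
  have small : eta ^+ 2 * maxP < 2.
    have d : 0 < 1 - eta ^+ 2 by lra.
    by rewrite -(ltr_pM2r d) -mulrA mPE; lra.
  pose x := of_PQ (2 * (n%:R - 2)) maxQ.
  have Ax : A x.
    rewrite A_box; apply/boxP; rewrite P_of_PQ Q_of_PQ !ger0_norm//; try lra.
    have : 0 <= eta ^+ 2 * maxP by rewrite mulr_ge0 ?sqr_ge0// ltW.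
    by split => //; lra.
  have : faceQ true x by rewrite faceQE; split => //=; rewrite Q_of_PQ mul1r.
  rewrite faceQ_unfold => -[k kn [y + eyx]]; rewrite faceP_unfold => -[z].
  rewrite faceQE => -[Az _] ezy.
  have Px : P x = eta ^+ 2 * P z + 2 * digit k.
    by rewrite -eyx P_ifs -ezy Q_ifs; ring.
  rewrite P_of_PQ in Px.
  have /boxP[+ _] : box z by rewrite -A_box.
  rewrite ler_norml => /andP[z1 z2].
  have g1 : eta ^+ 2 * P z <= eta ^+ 2 * maxP by rewrite ler_pM2l// exprn_gt0.
  have g2 : - (eta ^+ 2 * maxP) <= eta ^+ 2 * P z by rewrite -mulrN ler_pM2l// exprn_gt0.
  move: Px; rewrite /digit; case: k kn {eyx} => [|k] kn Px; first by lra.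
  have k0 : (0 : R) <= k%:R by [].
  by move: Px; rewrite -natr1; lra.
rewrite powRN powR12_sqrt; last by exact: ltW.
rewrite -[leRHS](ger0_norm (ltW eta_pos)) -sqrtr_sqr -sqrtrV ?(ltW n0)// ler_sqrt ?sqr_ge0//.
by rewrite -div1r ler_pdivrMr// mulrC.
Qed.

End ConvexAttractor.

End CaseB.

(** * The case mu = eta *)

Section SetType.
Context {T : topologicalType} (S : set T).

(** The characterisation of the Cantor space is about whole spaces, so the subset must become a
    compact space of its own. *)
Lemma set_type_compact : compact S -> compact [set: S].
Proof.
move=> cS G FG _.
have [x [Sx clx]] := cS (set_val @ G) _ (filterS (fun z _ => set_valP z) filterT).
exists (exist _ x (mem_set Sx)); split => // B C GB [_ [[U oU <-] Ux] UC].
have [z [[b Bb <-] Ub]] : (set_val @` B) `&` U !=set0.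
  apply: clx; last exact: open_nbhs_nbhs.
  by apply: (@filterS _ G _ B) GB => b Bb; exists b.
by exists b; split => //; exact: UC.
Qed.

Lemma set_type_hausdorff : hausdorff_space T -> hausdorff_space S.
Proof.
rewrite !open_hausdorff => hT x y xy.
have [|[U W] /= [xU yW] [oU oW UW]] := hT (set_val x) (set_val y).
  by apply: contra_neq xy => /val_inj.
exists (set_val @^-1` U, set_val @^-1` W) => /=.
  by split; rewrite inE; [move: xU|move: yW]; rewrite inE.
split; [by exists U|by exists W|].
by rewrite -preimage_setI (eqP UW) preimage_set0.
Qed.

End SetType.

(* In the subspace S, a level of f missed by S cuts S into two clopen pieces. *)
Lemma is_cantor_setP (R : realType) (S : set 'cV[R]_2) (f : 'cV[R]_2 -> R) :
  S !=set0 -> compact S -> continuous f ->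
  (forall x e, S x -> 0 < e -> exists y, [/\ S y, y <> x & `|x - y| < e]) ->
  (forall x y, S x -> S y -> x <> y -> exists c,
     (f x < c < f y \/ f y < c < f x) /\ forall z, S z -> f z <> c) ->
  is_cantor_set S.
Proof.
move=> [a Sa] cS fc perf sep.
pose T : pseudoPMetricType R := HB.pack (set_type S)
  (isPointed.Build (set_type S) (exist _ a (mem_set Sa))).
have open_pre U : open U -> open (set_val @^-1` U : set T) by move=> oU; exists U.
have valS (x : T) : S (set_val x) by exact: set_valP.
have clopen_cut c : (forall z, S z -> f z <> c) ->
    clopen ((f \o set_val) @^-1` [set r | r < c] : set T).
  move=> Sc; split.
    by apply: (open_pre (f @^-1` [set r | r < c])); apply: open_comp => //; exact: open_lt.
  rewrite -openC.
  suff -> : ~` ((f \o set_val) @^-1` [set r | r < c]) =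
      (set_val @^-1` (f @^-1` [set r | c < r]) : set T).
    by apply: open_pre; apply: open_comp => //; exact: open_gt.
  apply/seteqP; split=> x /=.
    move=> /negP; rewrite -leNgt le_eqVlt => /orP[/eqP e|//].
    by case: (Sc _ (valS x)).
  by move=> lt; apply/negP; rewrite -leNgt ltW.
have cl : cantor_like T.
  split.
  - apply/perfectTP => x [U oU Ux].
    have : nbhs (set_val x) U.
      apply: open_nbhs_nbhs; split => //.
      by have : (set_val @^-1` U) x by rewrite Ux.
    move=> /nbhs_ballP[e /= e0 eU].
    have [y [Sy yx xy]] := perf _ _ (valS x) e0.
    have : (set_val @^-1` U) (exist _ y (mem_set Sy) : T).
      by apply: eU; rewrite -ball_normE.
    by rewrite Ux => /(congr1 set_val) /= /yx.
  - exact: set_type_compact.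
  - by apply: set_type_hausdorff; exact: norm_hausdorff.
  - move=> x y xy.
    have xy' : set_val x <> set_val y by move=> /val_inj e; rewrite e eqxx in xy.
    have [c [[/andP[xc cy]|/andP[yc cx]] Sc]] := sep _ _ (valS x) (valS y) xy'.
      exists ((f \o set_val) @^-1` [set r | r < c]); split => //; first exact: (clopen_cut c Sc).
      by apply/negP; rewrite -leNgt ltW.
    exists (~` ((f \o set_val) @^-1` [set r | r < c])); split.
    + exact: (clopenC setT (clopen_cut c Sc)).
    + by apply/negP; rewrite -leNgt ltW.
    + by apply; exact: yc.
have [h [hc hclosed]] := homeomorphism_cantor_like cl.
pose k : T -> cantor_space := (h^-1)%FUN.
have hK : cancel h k by move=> z; apply: funK; rewrite inE.
have Kh : cancel k h by move=> z; apply: invK; rewrite inE.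
(* The value [point] outside [S] is a dummy: continuity of [g] is claimed only within [S]. *)
pose g (x : 'cV[R]_2) : cantor_space :=
  if pselect (S x) is left Sx then k (exist _ x (mem_set Sx) : T) else point.
exists (set_val \o h), g; split.
- move=> z; apply: continuous_comp; first exact: hc.
  exact: initial_continuous.
- apply/subspace_sigL_continuousP/continuous_closedP => B clB.
  (* Continuity of the inverse is the closedness of [h]. *)
  suff -> : sigL S g @^-1` B = h @` B by exact: hclosed.
  apply/seteqP; split=> x.
    rewrite /sigL /= /g; case: pselect => // Sx Bx.
    by exists (k x); rewrite ?Kh//; move: Bx; congr (B (k _)); exact/val_inj.
  move=> [b Bb <-]; rewrite /sigL /= /g; case: pselect => [Sx|/(_ (valS _))//].
  suff -> : exist _ (set_val (h b)) (mem_set Sx) = h b by rewrite hK.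
  exact/val_inj.
- apply/seteqP; split=> x; first by move=> [z _ <-]; exact: valS.
  by move=> Sx; exists (k (exist _ x (mem_set Sx) : T)) => //=; rewrite Kh.
- move=> z; rewrite /g /=; case: pselect => [Sx|/(_ (valS _))//].
  suff -> : exist _ (set_val (h z)) (mem_set Sx) = h z by rewrite hK.
  exact/val_inj.
Qed.

Lemma segment_compact_plane (R : realType) (p q : 'cV[R]_2) : compact (segment p q).
Proof.
apply: continuous_compact; last exact: segment_compact.
apply: continuous_subspaceT => t.
apply: (@continuousD _ _ _ (fun s : R => (1 - s) *: p) (fun s : R => s *: q)).
  apply: (@cvgZr_tmp _ _ _ _ _ (fun s : R => 1 - s)).
  by apply: cvgB; [exact: cvg_cst|exact: cvg_id].
by apply: (@cvgZr_tmp _ _ _ _ _ (fun s : R => s)); exact: cvg_id.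
Qed.

Section CaseD.
Context {R : realType} (n : nat) (w : 'cV[R]_2) (eta : R).
Context (w0 : w 0 0 <> 0) (w1 : w 1 0 <> 0) (eta_pos : 0 < eta) (eta_lt1 : eta < 1).
Local Notation V := 'cV[R]_2.
Local Notation F := (ifs eta eta w n).
Local Notation digit := (@digit R n).
Local Notation sg := (@sg R).
Context (n2 : (2 <= n)%N) (A : set V) (hA : is_attractor F n A).

Let eta_bounds : -1 < eta < 1.
Proof. by rewrite eta_lt1 andbT (lt_trans _ eta_pos)// oppr_lt0. Qed.

Let nat2 : 2 <= n%:R :> R.
Proof. by rewrite ler_nat. Qed.

(** The fixed point of [t |-> eta * t + (n%:R - 1)], which is [F 0] in the coordinate along [w]. *)
Definition halfwidth : R := (n%:R - 1) / (1 - eta).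

Lemma halfwidth_gt0 : 0 < halfwidth.
Proof. by move: nat2 (eta_lt1) => h1 h2; apply: divr_gt0; lra. Qed.

Lemma halfwidthE : halfwidth = eta * halfwidth + (n%:R - 1).
Proof.
by move: (eta_lt1) => h; rewrite /halfwidth; field; rewrite subr_eq0 gt_eqF.
Qed.

Lemma ifs_line k t : F k (t *: w) = (eta * t + digit k) *: w.
Proof. by apply: colP2; rewrite ?ifs_coord0 ?ifs_coord1 !mxE; ring. Qed.

Lemma scale_w_inj s t : s *: w = t *: w -> s = t.
Proof.
move=> /matrixP/(_ 0 0); rewrite !mxE => /mulIf; apply; exact/eqP.
Qed.

Definition end_point b : V := (sg b * halfwidth) *: w.

Lemma end_point_fixed b : unique (is_fixed_point (F (top n b))) (end_point b).
Proof.
split.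
  rewrite /is_fixed_point /end_point ifs_line (digit_top n2); congr (_ *: w).
  by rewrite [in RHS]halfwidthE; ring.
move=> y fy; have e1 : 1 - eta != 0 by rewrite subr_eq0 gt_eqF.
apply: colP2; apply: (mulfI e1).
  have := congr1 (fun z : V => z 0 0) fy; rewrite /= ifs_coord0.
  rewrite (digit_top n2) /end_point !mxE /halfwidth => e.
  have -> : (1 - eta) * y 0 0 = y 0 0 - eta * y 0 0 by ring.
  by rewrite -{1}e; field.
have := congr1 (fun z : V => z 1 0) fy; rewrite /= ifs_coord1.
rewrite (digit_top n2) /end_point !mxE /halfwidth => e.
have -> : (1 - eta) * y 1 0 = y 1 0 - eta * y 1 0 by ring.
by rewrite -{1}e; field.
Qed.

Definition hull_segment := segment (end_point true) (end_point false).

Lemma hull_segmentP x :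
  hull_segment x <-> exists2 t, - halfwidth <= t <= halfwidth & x = t *: w.
Proof.
move: halfwidth_gt0 => m0; rewrite /hull_segment /end_point /sg; split.
  move=> [t + <-]; rewrite /= in_itv /= => /andP[t0 t1].
  have g1 : 0 <= t * halfwidth by rewrite mulr_ge0// ltW.
  have g2 : 0 <= (1 - t) * halfwidth by rewrite mulr_ge0 ?subr_ge0// ltW.
  exists ((1 - 2 * t) * halfwidth); first by apply/andP; split; lra.
  by rewrite !scalerA -scalerDl; congr (_ *: w); ring.
move=> [t /andP[t0 t1] ->]; exists ((halfwidth - t) / (2 * halfwidth)).
  rewrite /= in_itv /=; apply/andP; split; first by apply: divr_ge0; lra.
  by rewrite ler_pdivrMr; lra.
by rewrite !scalerA -scalerDl; congr (_ *: w); field; rewrite gt_eqF.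
Qed.

Lemma hull_segment_nonempty_compact : nonempty_compact hull_segment.
Proof.
split; last exact: segment_compact_plane.
exists 0; apply/hull_segmentP; exists 0; last by rewrite scale0r.
by rewrite oppr_le0 ltW ?halfwidth_gt0.
Qed.

(** All maps send the segment into itself, so the contraction draws [A] into it; in particular [A]
    lies on the line of [w]. *)
Lemma attractor_hull_segment : A `<=` hull_segment.
Proof.
apply: (@attracted_subset _ n w eta eta eta_bounds eta_bounds unit (fun=> A)
  (fun=> hull_segment) _ _ _ tt).
- by move=> _; exact: hA.1.2.
- by move=> _; exact: hull_segment_nonempty_compact.
- move=> _ x /(attractor_cover hA)[k [y [kn Ay ->]]]; exists k, tt, y; split => //.
  move=> _ [_ /hull_segmentP[t /andP[t0 t1] ->] <-]; rewrite ifs_line.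
  apply/hull_segmentP; exists (eta * t + digit k) => //.
  have := @digit_bound R n true k kn; have := @digit_bound R n false k kn.
  rewrite /sg mul1r mulN1r => d0 d1; rewrite halfwidthE.
  have g1 : eta * t <= eta * halfwidth by rewrite ler_pM2l.
  have g2 : - (eta * halfwidth) <= eta * t by rewrite -mulrN ler_pM2l.
  by apply/andP; split; lra.
Qed.

Lemma end_point_attractor b : A (end_point b).
Proof.
apply: (@attracted_subset _ n w eta eta eta_bounds eta_bounds unit
  (fun=> [set end_point b]) (fun=> A) _ _ _ tt) => //.
- by move=> _; exact: compact_set1.
- by move=> _; case: hA.
- move=> _ _ ->; exists (top n b), tt, (end_point b).
  split => //; first by rewrite (end_point_fixed b).1.
  by move=> _ [x Ax <-]; apply: (attractor_ifs hA) => //; exact: (top_lt n2).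
Qed.

Lemma end_point_neq : end_point true <> end_point false.
Proof. by move=> /scale_w_inj; rewrite /sg; move: halfwidth_gt0; lra. Qed.

Lemma convex_hull_segment : convex_hull A = hull_segment.
Proof.
apply/seteqP; split.
  apply: convex_hull_min; [exact: segment_convex|exact: attractor_hull_segment].
apply: segment_sub_convex; first exact: convex_hull_convex.
  by apply: sub_convex_hull; exact: end_point_attractor.
by apply: sub_convex_hull; exact: end_point_attractor.
Qed.

Lemma hull_segment_sub_line : hull_segment `<=` line_spanned w.
Proof. by move=> _ /hull_segmentP[t _ ->]; exists t. Qed.

(** When [1 <= n%:R * eta], the images of the segment have half-length [eta * halfwidth] at least 1
    and centres 2 apart. They cover the segment, which is therefore attracted into [A]. *)
Lemma attractor_segment : n%:R^-1 <= eta -> A = hull_segment.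
Proof.
move=> ne; apply/seteqP; split; first exact: attractor_hull_segment.
move: (eta_pos) (eta_lt1) nat2 halfwidth_gt0 => e0 e1 h2 m0.
have {}ne : 1 <= n%:R * eta by rewrite mulrC -ler_pdivrMr ?div1r//; lra.
have em : 1 <= eta * halfwidth.
  by rewrite /halfwidth mulrA ler_pdivlMr; lra.
(* Induction on how far left the covered range extends: a point above piece [j.+1] is already within
   the range of [j]. *)
have cover t j : (j < n)%N -> digit j - eta * halfwidth <= t -> t <= halfwidth ->
    exists2 k, (k < n)%N & - (eta * halfwidth) <= t - digit k <= eta * halfwidth.
  elim: j => [|j IH] jn tj th.
    exists 0%N => //; move: halfwidthE tj; rewrite /digit => hE tj.
    by apply/andP; split; lra.
  have [h|h] := leP t (digit j.+1 + eta * halfwidth).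
    by exists j.+1 => //; apply/andP; split; lra.
  apply: IH => //; first exact: ltnW.
  by move: h; rewrite /digit -natr1; lra.
apply: (@attracted_subset _ n w eta eta eta_bounds eta_bounds unit (fun=> hull_segment)
  (fun=> A) _ _ _ tt).
- by move=> _; exact: hull_segment_nonempty_compact.2.
- by move=> _; case: hA.
move=> _ _ /hull_segmentP[t /andP[t0 t1] ->].
have [|||k kn /andP[k0 k1]] := cover t n.-1; [by lia| |exact: t1|].
  have := @digit_top R n n2 false; rewrite /top /sg => ->.
  by move: halfwidthE; lra.
exists k, tt, (((t - digit k) / eta) *: w); split => //.
- by rewrite ifs_line; congr (_ *: w); field; rewrite gt_eqF.
- apply/hull_segmentP; exists ((t - digit k) / eta) => //.
  by rewrite ler_pdivrMr// ler_pdivlMr//; apply/andP; split; lra.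
- by move=> _ [x Ax <-]; exact: attractor_ifs.
Qed.

Lemma piece_unfold t : A (t *: w) -> exists k t',
  [/\ (k < n)%N, A (t' *: w), t = eta * t' + digit k & - halfwidth <= t' <= halfwidth].
Proof.
move=> /(attractor_cover hA)[k [y [kn Ay e]]].
have /hull_segmentP[t' t'm ey] := attractor_hull_segment Ay.
exists k, t'; split => //; first by rewrite -ey.
by apply: scale_w_inj; rewrite -ifs_line -ey.
Qed.

Lemma digit_near_eq j k : -2 < digit j - digit k < 2 -> j = k.
Proof.
rewrite /digit => /andP[h1 h2]; case: (ltngtP j k) => // lt; exfalso.
  have : (j.+1%:R : R) <= k%:R by rewrite ler_nat.
  by rewrite -natr1; lra.
have : (k.+1%:R : R) <= j%:R by rewrite ler_nat.
by rewrite -natr1; lra.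
Qed.

(** All digits have the same parity, so [digit k + 1] is at distance at least 1 from each of
    them. *)
Lemma digit_parity j k : ~ (-1 < digit k + 1 - digit j < 1).
Proof.
rewrite /digit => /andP[h1 h2]; case: (leqP k j) => lt.
  have : (k%:R : R) <= j%:R by rewrite ler_nat.
  by lra.
have : (j.+1%:R : R) <= k%:R by rewrite ler_nat.
by rewrite -natr1; lra.
Qed.

(** * Case (d) with [eta < 1 / n]: the Cantor set *)

Section Gaps.
Context (small_eta : eta < n%:R^-1).

(** A restatement of [n%:R * eta < 1]: pieces reach less than 1 from their centres, so no piece
    contains [digit k + 1]. *)
Let gap : eta * halfwidth < 1.
Proof.
move: (small_eta) (eta_lt1) nat2 => h1 h2 h3.
have {}h1 : n%:R * eta < 1 by rewrite mulrC -ltr_pdivlMr ?div1r//; lra.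
by rewrite /halfwidth mulrA ltr_pdivrMr; lra.
Qed.

Let scaled_bound t : - halfwidth <= t <= halfwidth -> -1 < eta * t < 1.
Proof.
move: gap => g /andP[t0 t1].
have g1 : eta * t <= eta * halfwidth by rewrite ler_pM2l.
have g2 : - (eta * halfwidth) <= eta * t by rewrite -mulrN ler_pM2l.
by apply/andP; split; lra.
Qed.

(* An interval inside A lies in a single piece, because the pieces are separated by
   gaps; rescaling that piece to A lengthens the interval by the factor 1 / eta. *)
Lemma interval_length_le i s t : s <= t ->
  (forall c, s <= c <= t -> A (c *: w)) -> t - s <= eta ^+ i * (2 * halfwidth).
Proof.
elim: i s t => [|i IH] s t st sub.
  have /hull_segmentP[t' /andP[t0 t1] /scale_w_inj et] : hull_segment (t *: w).
    by apply/attractor_hull_segment/sub; rewrite st lexx.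
  have /hull_segmentP[s' /andP[s0 s1] /scale_w_inj es] : hull_segment (s *: w).
    by apply/attractor_hull_segment/sub; rewrite st lexx.
  by rewrite expr0 mul1r et es; lra.
have [k [s' [kn As' es s'm]]] : exists k t', [/\ (k < n)%N, A (t' *: w),
    s = eta * t' + digit k & - halfwidth <= t' <= halfwidth].
  by apply: piece_unfold; apply: sub; rewrite lexx.
have [l [t' [ln At' et t'm]]] : exists k t', [/\ (k < n)%N, A (t' *: w),
    t = eta * t' + digit k & - halfwidth <= t' <= halfwidth].
  by apply: piece_unfold; apply: sub; rewrite lexx st.
have /andP[s1 s2] := scaled_bound s'm; have /andP[t1 t2] := scaled_bound t'm.
have kl : l = k.
  apply: digit_near_eq; apply/andP; split; first by lra.
  (* If the endpoints lay in different pieces, the interval would contain the uncovered point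
     [digit k + 1]. *)
  rewrite ltNge; apply/negP => far.
  have [j [c [_ _ ec cm]]] : exists j c, [/\ (j < n)%N, A (c *: w),
      digit k + 1 = eta * c + digit j & - halfwidth <= c <= halfwidth].
    by apply: piece_unfold; apply: sub; apply/andP; split; lra.
  apply: (@digit_parity j k); have /andP[c1 c2] := scaled_bound cm.
  by apply/andP; split; lra.
move: et; rewrite {l ln}kl => et.
have st' : s' <= t' by rewrite -(ler_pM2l eta_pos); lra.
have := IH s' t' st'; rewrite es et exprS -mulrA => {}IH.
have -> : eta * t' + digit k - (eta * s' + digit k) = eta * (t' - s') by ring.
rewrite ler_pM2l//; apply: IH => c /andP[sc ct].
have cm : - halfwidth <= c <= halfwidth.
  by move: s'm t'm => /andP[? ?] /andP[? ?]; apply/andP; split; lra.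
have [j [c' [_ Ac' ec c'm]]] : exists j c', [/\ (j < n)%N, A (c' *: w),
    eta * c + digit k = eta * c' + digit j & - halfwidth <= c' <= halfwidth].
  apply: piece_unfold; apply: sub; rewrite es et !lerD2r.
  by rewrite !(ler_pM2l eta_pos) sc ct.
have /andP[c1 c2] := scaled_bound cm; have /andP[c1' c2'] := scaled_bound c'm.
(* A point lies in only one piece, so its preimage under [F k] is the point of [A] just found. *)
have kj : k = j by apply: digit_near_eq; apply/andP; split; lra.
move: ec; rewrite kj => /addIr/(mulfI (lt0r_neq0 eta_pos)) ->.
by [].
Qed.

Lemma attractor_gap s t : s < t -> exists2 c, s < c < t & ~ A (c *: w).
Proof.
move=> st; apply: contrapT => nogap.
(* The absence of gaps is known for the open interval; its middle third is a closed interval of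
   positive length. *)
pose s1 := s + (t - s) / 3; pose t1 := t - (t - s) / 3.
have s1t1 : s1 < t1 by rewrite /s1 /t1; lra.
have sub c : s1 <= c <= t1 -> A (c *: w).
  rewrite /s1 /t1 => /andP[c1 c2]; apply: contrapT => nA; apply: nogap.
  by exists c => //; apply/andP; split; lra.
have cv : geometric (2 * halfwidth) eta @ \oo --> 0.
  by apply: cvg_geometric; rewrite ger0_norm// ltW.
have d0 : 0 < t1 - s1 by rewrite subr_gt0.
move/cvgrPdist_lt : cv => /(_ _ d0)[i _ /(_ i (leqnn i))] /=.
rewrite sub0r normrN ger0_norm; last first.
  by rewrite mulr_ge0 ?exprn_ge0 ?ltW// mulr_gt0// halfwidth_gt0.
by rewrite ltNge mulrC (interval_length_le _ (ltW s1t1) sub).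
Qed.

(** [A] has two points, the ends of its hull. Following the unfolding of [x] for i steps and
    carrying back a point different from the one reached gives, as the maps are injective
    contractions, a different point close to [x]. *)
Lemma attractor_perfect x e : A x -> 0 < e ->
  exists y, [/\ A y, y <> x & `|x - y| < e].
Proof.
move=> Ax e0.
have [M AM] := @compact_norm_bound _ unit (fun=> A) (fun=> hA.1.2).
have approx i : forall x, A x ->
    exists y, [/\ A y, y <> x & `|x - y| <= ratio eta eta ^+ i * (M + M)].
  elim: i => [|i IH] {e e0 Ax}x Ax.
    have [y Ay yx] : exists2 y, A y & y <> x.
      have [e|ne] := pselect (end_point true = x).
        exists (end_point false); first exact: end_point_attractor.
        by rewrite -e => /esym/end_point_neq.
      by exists (end_point true) => //; exact: end_point_attractor.
    exists y; split => //; rewrite expr0 mul1r (le_trans (ler_normB _ _))//.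
    by apply: lerD; exact: (AM tt).
  have [k [x' [kn Ax' ->]]] := attractor_cover hA Ax.
  have [y' [Ay' yx' xy']] := IH _ Ax'.
  have /andP[r0 _] := ratio_bound eta_bounds eta_bounds.
  exists (F k y'); split; first exact: attractor_ifs.
    have en : eta != 0 by rewrite gt_eqF.
    move=> e; apply: yx'; apply: colP2.
      have := congr1 (fun z : V => z 0 0) e.
      by rewrite /= !ifs_coord0 => /addIr/(mulfI en).
    have := congr1 (fun z : V => z 1 0) e.
    by rewrite /= !ifs_coord1 => /addIr/(mulfI en).
  rewrite exprS -mulrA (le_trans (ifs_contracting n w eta_bounds eta_bounds k x' y'))//.
  by rewrite ler_wpM2l.
have /andP[r0 r1] := ratio_bound eta_bounds eta_bounds.
have cv : geometric (M + M) (ratio eta eta) @ \oo --> 0.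
  by apply: cvg_geometric; rewrite ger0_norm.
move/cvgrPdist_lt : cv => /(_ _ e0)[i _ /(_ i (leqnn i))] /=.
rewrite sub0r normrN mulrC => lt.
have [y [Ay yx xy]] := approx i x Ax; exists y; split => //.
exact: le_lt_trans (le_trans xy (ler_norm _)) lt.
Qed.

Lemma attractor_cantor : is_cantor_set A.
Proof.
have wn : w 0 0 != 0 by exact/eqP.
have XE t : pairing w (1, 0) (t *: w) = t.
  by rewrite /pairing !mxE /= mul0r addr0 mul1r mulfK.
apply: (is_cantor_setP (f := pairing w (1, 0))).
- by case: hA => -[].
- by case: hA => -[].
- exact: pairing_continuous.
- exact: attractor_perfect.
- move=> x y Ax Ay.
  have /hull_segmentP[s _ ->] := attractor_hull_segment Ax.
  have /hull_segmentP[t _ ->] := attractor_hull_segment Ay.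
  rewrite !XE => st.
  have level c : ~ A (c *: w) -> forall z, A z -> pairing w (1, 0) z <> c.
    move=> nA z Az; have /hull_segmentP[r _ ez] := attractor_hull_segment Az.
    by rewrite ez XE => rc; apply: nA; rewrite -rc -ez.
  have [lt|lt|e] := ltgtP s t; last by case: st; rewrite e.
    by have [c sct nA] := attractor_gap lt; exists c; split; [left|exact: level].
  by have [c sct nA] := attractor_gap lt; exists c; split; [right|exact: level].
Qed.

End Gaps.

End CaseD.

Theorem theorem4p1 (R : realType) (n : nat) (w : 'cV[R]_2) (mu eta : R)
    (A : set 'cV[R]_2)
    (hn : (2 <= n)%N) (hw0 : w 0 0 <> 0) (hw1 : w 1 0 <> 0)
    (hmu0 : mu <> 0) (heta0 : eta <> 0)
    (hmu : -1 < mu < 1) (heta : -1 < eta < 1)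
    (hA : is_attractor (ifs mu eta w n) n A) :
  [/\ (mu < 0 -> 0 < eta -> `|mu| < eta ->
        exists B0 B1 B2 B3 : set 'cV[R]_2,
          is_unique_solution (system_a (ifs mu eta w n) n) B0 B1 B2 B3 /\
          ext A = B0 `|` B1 `|` B2 `|` B3),
      (mu < 0 -> 0 < eta -> `|mu| = eta ->
        exists B0 B1 B2 B3 : set 'cV[R]_2,
          [/\ is_unique_solution (system_b (ifs mu eta w n) n) B0 B1 B2 B3,
              ext A = B0 `|` B1 `|` B2 `|` B3,
              is_quadrilateral (convex_hull A) &
              (is_convex A ->
                n%:R `^ (- 2^-1) <= eta /\
                [/\ is_edge A B0, is_edge A B1, is_edge A B2 & is_edge A B3])]),
      (0 < mu -> mu < eta ->
        exists B0 B1 B2 B3 : set 'cV[R]_2,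
          is_unique_solution (system_c (ifs mu eta w n) n) B0 B1 B2 B3 /\
          ext A = B0 `|` B1 `|` B2 `|` B3) &
      (0 < mu -> mu = eta ->
        [/\ (eta < n%:R^-1 -> is_cantor_set A),
            (n%:R^-1 <= eta -> is_segment A) &
            exists p q : 'cV[R]_2,
              [/\ unique (is_fixed_point (ifs mu eta w n 0)) p,
                  unique (is_fixed_point (ifs mu eta w n n.-1)) q,
                  p <> q,
                  convex_hull A = segment p q &
                  convex_hull A `<=` line_spanned w]])].
Proof.
split.
- move=> mu0 eta0 mueta.
  apply: (system_a_solution hw0 hw1 hmu heta hn hA mu0 eta0).
  by rewrite ltr0_norm// in mueta; rewrite ltrNl.
- move=> mu0 eta0 mueta.
  have muE : mu = - eta by rewrite -mueta ltr0_norm// opprK.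
  have eta1 : eta < 1 by case/andP: heta.
  move: hA; rewrite muE => hA'.
  exists (faceQ w A false), (faceP w A false), (faceQ w A true), (faceP w A true).
  split.
  + exact: (system_b_faces hw0 hw1 eta0 eta1 hn hA').
  + exact: (ext_faces hw0 hw1 eta0 eta1 hn hA').
  + exact: (hull_quadrilateral hw0 hw1 eta0 eta1 hn hA').
  + move=> cA; split; first exact: (convex_ratio hw0 hw1 eta0 eta1 hn hA' cA).
    split; first [exact: (faceQ_edge hw0 hw1 eta0 eta1 hn hA' cA)
                 |exact: (faceP_edge hw0 hw1 eta0 eta1 hn hA' cA)].
- move=> mu0 mueta.
  exact: (system_c_solution hw0 hw1 hmu heta hn hA mu0 mueta).
- move=> mu0 mueta; move: hA; rewrite mueta => hA'.
  have eta0 : 0 < eta by rewrite -mueta.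
  have eta1 : eta < 1 by case/andP: heta.
  split.
  + exact: (attractor_cantor hw0 eta0 eta1 hn hA').
  + move=> ne; exists (end_point n w eta true), (end_point n w eta false); split.
      exact: end_point_neq.
    exact: attractor_segment.
  + exists (end_point n w eta true), (end_point n w eta false); split.
    * exact: end_point_fixed.
    * exact: end_point_fixed.
    * exact: end_point_neq.
    * exact: convex_hull_segment.
    * rewrite (convex_hull_segment eta0 eta1 hn hA').
      exact: hull_segment_sub_line.
Qed.
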